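(* Let $T$ and $T'$ be increasing tableaux of type A. Then $T$ and $T'$ are $K$-Knuth equivalent if and only if $T$ and $T'$ are jeu de taquin equivalent for $\mathbb{N}^2$.
   Context: **Type A.** Let $\Lambda=\mathbb{N}^2$ ($\mathbb{N}=\{1,2,3,\dots\}$), whose elements $[r,c]$ are boxes in row $r$ (rows numbered top to bottom) and column $c$ (columns numbered left to right), with partial order $[r_1,c_1]\le[r_2,c_2]$ iff $r_1\le r_2$ and $c_1\le c_2$. A straight shape is a finite lower order ideal of $\mathbb{N}^2$ (a Young diagram, identified with a partition); a skew shape is $\nu/\lambda:=\nu\setminus\lambda$ with $\lambda\subset\nu$ straight shapes. An increasing tableau of type A is a map $T:\nu/\lambda\to\mathbb{Z}$ on a skew shape with $T(\alpha)<T(\beta)$ whenever $\alpha<\beta$, i.e. rows strictly increase left to right and columns strictly increase top to bottom. **Slides.** Two boxes are neighbors if one covers the other. For a tableau $Y$ with values in a set $S$ and $s,s'\in S$, $\mathrm{swap}_{s,s'}(Y)$ is the tableau of the same shape sending $\alpha$ to $s'$ if $Y(\alpha)=s$ and $Y(\beta)=s'$ for some neighbor $\beta$ of $\alpha$; to $s$ if $Y(\alpha)=s'$ and $Y(\beta)=s$ for some neighbor $\beta$ of $\alpha$; and to $Y(\alpha)$ otherwise. If $T$ is increasing of shape $\nu/\lambda$ with values in $[a,b]$ and $C$ is a set of maximal boxes of $\lambda$, the forward slide $\mathrm{jdt}_C(T)$ is obtained by adding the boxes of $C$ filled with $\bullet$, applying $\mathrm{swap}_{a,\bullet},\mathrm{swap}_{a+1,\bullet},\dots,\mathrm{swap}_{b,\bullet}$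 in this order, and deleting all boxes containing $\bullet$. If $\widehat C$ is a set of minimal boxes of $\mathbb{N}^2\setminus\nu$, the reverse slide starting from $\widehat C$ is obtained by adding the boxes of $\widehat C$ filled with $\bullet$, applying $\mathrm{swap}_{b,\bullet},\mathrm{swap}_{b-1,\bullet},\dots,\mathrm{swap}_{a,\bullet}$ in this order, and deleting all boxes containing $\bullet$. The results are increasing tableaux. Two increasing tableaux are jeu de taquin equivalent for $\mathbb{N}^2$ if one is obtained from the other by a sequence of forward and reverse slides. **$K$-Knuth equivalence.** The relation $\equiv$ on words of integers is the equivalence relation generated by the following, for all words $\mathbf{u},\mathbf{v}$ and integers $a,b,c$: $(\mathbf{u},a,a,\mathbf{v})\equiv(\mathbf{u},a,\mathbf{v})$; $(\mathbf{u},a,b,a,\mathbf{v})\equiv(\mathbf{u},b,a,b,\mathbf{v})$; $(\mathbf{u},a,b,c,\mathbf{v})\equiv(\mathbf{u},a,c,b,\mathbf{v})$ if $b<a<c$; $(\mathbf{u},a,b,c,\mathbf{v})\equiv(\mathbf{u},b,a,c,\mathbf{v})$ if $a<c<b$. A reading word of an increasing tableau $T$ is any word listing the entries of the boxes of $T$ in an order in which each box $[r,c]$ appears before all other boxes $[r',c']$ of $T$ with $r'\le r$ and $c'\ge c$; for example the row word, which reads the rows left to right starting with the bottom row. All reading words of a given increasing tableau are $K$-Knuth equivalent. Two increasing tableaux are $K$-Knuth equivalent if a reading word of one is $K$-Knuth equivalent to a reading word of the other. *)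

(* Defs.v *)
From Stdlib Require Export Relations.Relation_Operators.
From mathcomp Require Export all_boot all_order all_algebra finmap.

Set Implicit Arguments.
Unset Strict Implicit.
Unset Printing Implicit Defensive.

Import Order.TTheory GRing.Theory Num.Theory.

Local Open Scope nat_scope.
Local Open Scope fset_scope.
Local Open Scope fmap_scope.

(* A box is a pair (row, column).  Both coordinates start at 0, so that the box
   [r, c] of {1, 2, ...}^2 is (r - 1, c - 1); [*p] carries the componentwise
   order. *)
Definition box := (nat *p nat)%type.

Definition covers (x y : box) : Prop :=
  (x < y)%O /\ ~ (exists z : box, (x < z)%O /\ (z < y)%O).

Definition neighbor (x y : box) : bool :=
  ((x.1 == y.1) && ((x.2.+1 == y.2) || (y.2.+1 == x.2))) ||
  ((x.2 == y.2) && ((x.1.+1 == y.1) || (y.1.+1 == x.1))).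

Lemma box_ltE (x y : box) :
  (x < y)%O = [&& x.1 <= y.1, x.2 <= y.2 & (x.1 != y.1) || (x.2 != y.2)].
Proof.
case: x y => [r c] [r' c'].
rewrite lt_neqAle /= andbC Order.ProdOrder.leEprod /= !leEnat -andbA.
by rewrite [(r, c) == (r', c') :> box]xpair_eqE negb_and.
Qed.

Lemma coversP (x y : box) :
  covers x y <->
  (x.1 = y.1 /\ x.2.+1 = y.2) \/ (x.2 = y.2 /\ x.1.+1 = y.1).
Proof.
case: x y => [r c] [r' c']; rewrite /covers; split => /=.
- rewrite box_ltE /= => -[/and3P [ler lec ne] noz].
  have [er|nr] := eqVneq r r'.
    move: ne; rewrite er eqxx /= => nc; left; split=> //.
    apply/eqP; rewrite eqn_leq [c < c']ltn_neqAle nc lec /= leqNgt.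
    apply/negP => lt; apply: noz; exists (r', c.+1).
    rewrite !box_ltE /= er leqnn leqnSn eqxx (ltnW lt) /=.
    by rewrite -[c == c.+1]negbK ?neq_ltn ?ltnSn ?lt.
  have ltr : r < r' by rewrite ltn_neqAle nr ler.
  have [ec|nc] := eqVneq c c'.
    right; split=> //; apply/eqP; rewrite eqn_leq ltr /= leqNgt.
    apply/negP => lt; apply: noz; exists (r.+1, c').
    by rewrite !box_ltE /= ec leqnn leqnSn (ltnW lt) /= !neq_ltn ltnSn lt.
  case: noz; exists (r, c').
  by rewrite !box_ltE /= !leqnn lec ler nr nc orbT.
- case=> -[-> <-]; (split; first by rewrite box_ltE /= !leqnn leqnSn !neq_ltn ltnSn ?orbT).
  + case=> -[p q] []; rewrite !box_ltE /= => /and3P[h1 h2 h3] /and3P[h4 h5 h6].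
    have e : r' = p by apply/eqP; rewrite eqn_leq h1 h4.
    move: h3 h6; rewrite e !eqxx /= => h3 h6.
    have : c < q by rewrite ltn_neqAle h3 h2.
    by rewrite ltnNge -ltnS ltn_neqAle h6 h5.
  + case=> -[p q] []; rewrite !box_ltE /= => /and3P[h1 h2 h3] /and3P[h4 h5 h6].
    have e : c' = q by apply/eqP; rewrite eqn_leq h2 h5.
    move: h3 h6; rewrite e !eqxx !orbF /= => h3 h6.
    have : r < p by rewrite ltn_neqAle h3 h1.
    by rewrite ltnNge -ltnS ltn_neqAle h6 h4.
Qed.

Lemma neighborP (x y : box) :
  reflect (covers x y \/ covers y x) (neighbor x y).
Proof.
apply: (iffP idP).
- case/orP => /andP[/eqP e /orP[] /eqP h]; [left|right|left|right]; apply/coversP.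
  + by left.
  + by left.
  + by right.
  + by right.
- by rewrite /neighbor; case=> /coversP [] [-> <-]; rewrite !eqxx ?orbT.
Qed.

Definition straight_shape (A : {fset box}) : Prop :=
  forall x y : box, (x <= y)%O -> y \in A -> x \in A.

(* The skew shape nu \ lam is identified with its set of boxes. *)
Definition skew_presentation (A nu lam : {fset box}) : Prop :=
  [/\ straight_shape lam, straight_shape nu, lam `<=` nu & A = nu `\` lam].

(* A filling of a finite set of boxes: the shape is the domain of the map. *)
Definition tableau := {fmap box -> int}.

Definition increasing (T : tableau) : Prop :=
  (exists nu lam, skew_presentation (domf T) nu lam) /\
  (forall x y : domf T, (val x < val y)%O -> (T x < T y)%R).

Definition maximal_in (A : {fset box}) (x : box) : Prop :=
  x \in A /\ forall y : box, y \in A -> (x <= y)%O -> y = x.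

Definition minimal_outside (A : {fset box}) (x : box) : Prop :=
  x \notin A /\ forall y : box, y \notin A -> (y <= x)%O -> y = x.

Definition swap (S : eqType) (s s' : S) (Y : {fmap box -> S}) :
    {fmap box -> S} :=
  [fmap x : domf Y =>
    if (Y x == s) && [exists y : domf Y, neighbor (val x) (val y) && (Y y == s')]
    then s'
    else
    if (Y x == s') && [exists y : domf Y, neighbor (val x) (val y) && (Y y == s)]
    then s
    else Y x].

(* Dotted tableaux take values in [option int], with [None] standing for the
   dot.  [T.[? x]] is [None] exactly when [x] is not a box of [T], so the boxes
   of [C] (disjoint from the shape of [T]) receive dots.  Conversely
   [reducef] removes from the domain the boxes with value [None]. *)
Definition add_dots (T : tableau) (C : {fset box}) : {fmap box -> option int} :=
  [fmap x : domf T `|` C => T.[? val x]].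

Definition delete_dots (Y : {fmap box -> option int}) : tableau := reducef Y.

(* The integers of [a, b] in increasing order. *)
Definition int_range (a b : int) : seq int :=
  if (a <= b)%R then [seq (a + k%:Z)%R | k <- iota 0 `|b - a|%N.+1] else [::].

Definition swap_dots (vs : seq int) (Y : {fmap box -> option int}) :
    {fmap box -> option int} :=
  foldl (fun Z v => swap (Some v) None Z) Y vs.

Definition forward_slide (a b : int) (C : {fset box}) (T : tableau) : tableau :=
  delete_dots (swap_dots (int_range a b) (add_dots T C)).

Definition reverse_slide (a b : int) (C : {fset box}) (T : tableau) : tableau :=
  delete_dots (swap_dots (rev (int_range a b)) (add_dots T C)).

Definition values_in (a b : int) (T : tableau) : Prop :=
  forall x : domf T, (a <= T x <= b)%R.

Inductive slide_step (T : tableau) : tableau -> Prop :=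
| ForwardSlide (nu lam C : {fset box}) (a b : int) of
    increasing T & skew_presentation (domf T) nu lam & values_in a b T &
    (forall x, x \in C -> maximal_in lam x) :
    slide_step T (forward_slide a b C T)
| ReverseSlide (nu lam C : {fset box}) (a b : int) of
    increasing T & skew_presentation (domf T) nu lam & values_in a b T &
    (forall x, x \in C -> minimal_outside nu x) :
    slide_step T (reverse_slide a b C T).

Definition jdt_equivalent : tableau -> tableau -> Prop :=
  clos_refl_trans tableau slide_step.

Inductive kknuth_step : seq int -> seq int -> Prop :=
| KKnuth_idem (u v : seq int) (a : int) :
    kknuth_step (u ++ [:: a; a] ++ v) (u ++ [:: a] ++ v)
| KKnuth_braid (u v : seq int) (a b : int) :
    kknuth_step (u ++ [:: a; b; a] ++ v) (u ++ [:: b; a; b] ++ v)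
| KKnuth_right (u v : seq int) (a b c : int) of (b < a < c)%R :
    kknuth_step (u ++ [:: a; b; c] ++ v) (u ++ [:: a; c; b] ++ v)
| KKnuth_left (u v : seq int) (a b c : int) of (a < c < b)%R :
    kknuth_step (u ++ [:: a; b; c] ++ v) (u ++ [:: b; a; c] ++ v).

Definition kknuth_word_equiv : seq int -> seq int -> Prop :=
  clos_refl_sym_trans (seq int) kknuth_step.

Definition reading_order (A : {fset box}) (s : seq box) : Prop :=
  [/\ uniq s, s =i A &
      forall x y : box, x \in A -> y \in A -> y != x ->
        (y.1 <= x.1) -> (x.2 <= y.2) -> index x s < index y s].

(* [pmap] drops nothing here, as all boxes of [s] lie in the domain of [T]. *)
Definition reading_word (T : tableau) (w : seq int) : Prop :=
  exists2 s : seq box, reading_order (domf T) s & w = pmap (fun x => T.[? x]) s.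

Definition kknuth_equivalent (T T' : tableau) : Prop :=
  exists w w' : seq int,
    [/\ reading_word T w, reading_word T' w' & kknuth_word_equiv w w'].

(* Main.v *)
(* A forward slide is described without its intermediate stages: the dotted
   shape S is convex, every entry stays in place or moves to one or two
   neighbouring boxes of S that precede it, and the dots are minimal in S
   beforehand and maximal afterwards (slide_rel).  This relation is exactly one
   slide, read forwards or backwards.

   Slides preserve the K-Knuth class: replace the old entries by the new ones
   box by box along the row word, first deleting the old entry, which is repeated
   in the box to the left or above, and then inserting the new one, which is
   repeated in the box to the right or below.  Two-row manipulations of words
   justify both operations.

   Conversely, shifting rows to the right by amounts that weakly decrease
   downwards is a sequence of slides preserving the row word.  Shifting rows,
   then columns, then rows again spreads a tableau out to an antidiagonal one
   determined by its row word.  Finally each K-Knuth relation comes from one slide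
   of a 2 x 2 block placed on an antidiagonal. *)

Require Import Defs.
From mathcomp Require Import all_boot all_order all_algebra finmap zify.

Set Implicit Arguments.
Unset Strict Implicit.
Unset Printing Implicit Defensive.

Import Order.TTheory GRing.Theory Num.Theory.

Local Open Scope fset_scope.
Local Open Scope fmap_scope.
Local Open Scope nat_scope.

(** * K-Knuth equivalence of words *)

(** Two features of [slide_rel] pay for the work of recovering the swaps from it. It does not
    mention the range of values, so slides can be exhibited without running them. It also makes
    forward and reverse slides one notion, so that invariance has to be shown for a single direction
    only.

    In the converse the obstacle is that a tableau must be recovered, up to slides, from its row
    word alone. Row shifts cannot separate boxes of one row vertically, and column shifts may change
    the row word. The initial row shift therefore puts all boxes into different columns; from then
    on reading by rows is also reading by columns from left to right, and shifting columns is
    harmless. The column shift then puts all boxes into different rows, and the last row shift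
    removes the remaining trace of the original columns, leaving positions that depend only on the
    length of the word and on a common spacing. *)

Notation "w =K w'" := (kknuth_word_equiv w w') (at level 70).

Lemma kk_refl w : w =K w. Proof. exact: rst_refl. Qed.

Lemma kk_sym w w' : w =K w' -> w' =K w. Proof. exact: rst_sym. Qed.

Lemma kk_trans w2 w1 w3 : w1 =K w2 -> w2 =K w3 -> w1 =K w3.
Proof. exact: rst_trans. Qed.

#[local] Hint Resolve kk_refl : core.

Lemma kk_cat p w w' q : w =K w' -> p ++ w ++ q =K p ++ w' ++ q.
Proof.
elim=> [x y|x|x y _|x y z _ IH1 _ IH2]; last 3 first.
- exact: kk_refl.
- exact: kk_sym.
- exact: kk_trans IH1 IH2.
case=> [u v a|u v a b|u v a b c h|u v a b c h]; apply: rst_step;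
  rewrite -!catA !(catA p u).
- exact: KKnuth_idem.
- exact: KKnuth_braid.
- exact: KKnuth_right.
- exact: KKnuth_left.
Qed.

Lemma kk_catl p w w' : w =K w' -> p ++ w =K p ++ w'.
Proof. by move=> h; have := kk_cat p [::] h; rewrite !cats0. Qed.

Lemma kk_catr q w w' : w =K w' -> w ++ q =K w' ++ q.
Proof. exact: (kk_cat [::]). Qed.

Lemma kk_cons a w w' : w =K w' -> a :: w =K a :: w'.
Proof. exact: (kk_catl [:: a]). Qed.

Lemma kk_idem a v : [:: a, a & v] =K a :: v.
Proof. exact/rst_step/(KKnuth_idem [::]). Qed.

Lemma kk_braid a b v : [:: a, b, a & v] =K [:: b, a, b & v].
Proof. exact/rst_step/(KKnuth_braid [::]). Qed.

Lemma kk_right a b c v :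
  (b < a < c)%R -> [:: a, b, c & v] =K [:: a, c, b & v].
Proof. by move=> h; apply/rst_step/(KKnuth_right [::]). Qed.

Lemma kk_left a b c v :
  (a < c < b)%R -> [:: a, b, c & v] =K [:: b, a, c & v].
Proof. by move=> h; apply/rst_step/(KKnuth_left [::]). Qed.

(** Reversing and negating maps idempotent and braid relations to relations of the same kind and
    exchanges the other two kinds. It carries [kk_insert] over to [kk_delete]. *)
Lemma kk_opp_rev w w' :
  w =K w' -> map (-%R)%R (rev w) =K map (-%R)%R (rev w').
Proof.
elim=> [x y|x|x y _|x y z _ IH1 _ IH2]; last 3 first.
- exact: kk_refl.
- exact: kk_sym.
- exact: kk_trans IH1 IH2.
case=> [u v a|u v a b|u v a b c h|u v a b c h];
  rewrite !rev_cat !map_cat -!catA; apply: kk_catl; rewrite /rev /=.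
- exact: kk_idem.
- exact: kk_braid.
- by apply: kk_left; lia.
- by apply: kk_right; lia.
Qed.

(** The letter [b] moves left over each letter [y] of the row; the predecessor [x] of [y] serves as
    the witness [b < x < y]. It stops behind the head, which has no predecessor. *)
Lemma kk_pull_head a A b v :
  sorted <%R (a :: A) -> (b < a)%R -> (a :: A) ++ b :: v =K [:: a, b & A ++ v].
Proof.
elim: A a v => [|a' A IH] a v //= /andP[aa' pA] ba.
apply: kk_trans (kk_cons a (IH a' v pA (lt_trans ba aa'))) _.
by apply/kk_sym/kk_right; rewrite ba.
Qed.

(* The upper row [b] slides to the left past the part [m :: A] of the lower row
   that lies strictly to its right; the prefix [P] does not depend on what follows. *)
Lemma kk_pull_row (js : seq nat) (a b : nat -> option int) m A :
  sorted <%R (pmap a js ++ m :: A) ->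
  (forall j y, j \in js -> b j = Some y -> exists2 x, a j = Some x & (y <= x)%R) ->
  exists P, forall v,
    (pmap a js ++ m :: A) ++ pmap b js ++ v =K P ++ m :: A ++ v.
Proof.
elim: js => [|j js IH] /=; first by move=> _ _; exists [::] => v; exact: kk_refl.
move=> sA hab.
have hab' k y : k \in js -> b k = Some y ->
    exists2 x, a k = Some x & (y <= x)%R.
  by move=> kj; apply: hab; rewrite inE kj orbT.
case aj: (a j) sA => [x|] /= sA; last first.
  case bj: (b j) => [y|] /=; last exact: IH.
  by have [|x] := hab j y _ bj; rewrite ?inE ?eqxx // aj.
have [P hP] := IH (path_sorted sA) hab'.
case bj: (b j) => [y|] /=; last first.
  by exists (x :: P) => v; apply: kk_cons; apply: hP.
have [|x' []] := hab j y _ bj; rewrite ?inE ?eqxx // aj => -[<-] yx.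
case E: (pmap a js ++ m :: A) sA hP => [|h B]; first by case: (pmap a js) E.
move=> /= /andP[xh pB] hP.
(* If [y < x], the letter [y] travels until it stands right behind [x]. If [y = x], the braid
   [x h x = h x h] leaves [h, x] in the prefix and gives back the row [h :: B] for the induction. *)
have [yx'|xy] := ltP y x; last have {yx xy} <- : x = y by lia.
  exists [:: x, y & P] => v.
  apply: kk_trans (kk_cons x (kk_pull_head _ pB (lt_trans yx' xh))) _.
  apply: kk_trans (kk_sym (kk_right _ _)) _; first by rewrite yx'.
  by do 2!apply: kk_cons; exact: hP.
exists [:: h, x & P] => v.
apply: kk_trans (kk_cons x (kk_pull_head _ pB xh)) _.
apply: kk_trans (kk_braid _ _ _) _.
by do 2!apply: kk_cons; exact: hP.
Qed.

(** Here [pmap a js ++ m :: A] is a row and [pmap b js ++ B] the row above it; the copy of [m] in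
    the lower row makes an [m] in the upper one redundant. Once [kk_pull_row] has moved the left
    part of the upper row into a common prefix, it remains to compare [m :: A ++ m :: B] with
    [m :: A ++ B]. *)
Lemma kk_insert (js : seq nat) (a b : nat -> option int) m A B :
  sorted <%R (pmap a js ++ m :: A) ->
  (forall j y, j \in js -> b j = Some y -> exists2 x, a j = Some x & (y <= x)%R) ->
  (forall a1 A', A = a1 :: A' ->
     exists b1 B', B = b1 :: B' /\ (m < b1 < a1)%R) ->
  (pmap a js ++ m :: A) ++ pmap b js ++ B =K
  (pmap a js ++ m :: A) ++ pmap b js ++ m :: B.
Proof.
move=> sA hab hAB; have [P hP] := kk_pull_row sA hab.
apply: kk_trans (hP _) _; apply/kk_sym/(kk_trans (hP _)); apply: kk_catl.
have {sA} : sorted <%R (m :: A) by have := sA; rewrite sorted_cat_cons => /andP[].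
case: A hAB {hP} => [|a1 A] hAB /= sA; first exact: kk_idem.
have [b1 [B' [-> /andP[mb ba]]]] := hAB _ _ erefl.
have sA' : sorted <%R (a1 :: A) by case/andP: sA.
have e v : [:: a1, m, b1 & v] =K [:: m, a1, b1 & v].
  by apply/kk_sym/kk_left; rewrite mb.
(* Apart from [A], the chain is [m a1 m b1 = a1 m a1 b1 = a1 a1 m b1 = a1 m b1 = m a1 b1]. *)
apply: kk_trans (kk_cons m (kk_pull_head _ sA' (lt_trans mb ba))) _.
apply: kk_trans (kk_braid _ _ _) _.
apply: kk_trans (kk_catl [:: a1; m] (kk_pull_head _ sA' ba)) _.
apply: kk_trans (kk_cons a1 (kk_sym (e _))) _.
apply: kk_trans (kk_idem _ _) _; apply: kk_trans (e _) _.
exact/kk_cons/kk_sym/(kk_pull_head _ sA' ba).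
Qed.

(* The mirror image of [kk_insert] under reversing words and negating letters. *)
Lemma kk_delete (js : seq nat) (a b : nat -> option int) m A B :
  sorted <%R (rcons A m ++ pmap a js) ->
  (forall j y, j \in js -> b j = Some y -> exists2 x, a j = Some x & (x <= y)%R) ->
  (forall A' a1, A = rcons A' a1 ->
     exists B' b1, B = rcons B' b1 /\ (a1 < b1 < m)%R) ->
  (B ++ pmap b js) ++ rcons A m ++ pmap a js =K
  (rcons B m ++ pmap b js) ++ rcons A m ++ pmap a js.
Proof.
move=> sA hab hAB.
pose neg (f : nat -> option int) j := omap (-%R)%R (f j).
pose N (w : seq int) := map (-%R)%R (rev w).
have NK w : N (N w) = w.
  by rewrite /N -map_rev revK -map_comp map_id_in // => x _ /=; rewrite opprK.
have NE w1 w2 : N (w1 ++ w2) = N w2 ++ N w1 by rewrite /N rev_cat map_cat.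
have Nr w x : N (rcons w x) = (- x)%R :: N w by rewrite /N rev_rcons.
have negE f : N (pmap f js) = pmap (neg f) (rev js).
  elim: js {sA hab} => //= j js IH; rewrite rev_cons -cats1 pmap_cat -IH.
  by rewrite /neg /oapp /=; case: (f j) => [x|] /=; rewrite ?cats0 // -cat1s NE.
have := @kk_insert (rev js) (neg a) (neg b) (- m)%R (N A) (N B).
rewrite -!negE -!Nr -!NE => /(_ _ _ _)/kk_opp_rev; rewrite -!/(N _) !NK; apply.
- by rewrite /N sorted_map rev_sorted; apply: sub_sorted sA => x y /=; lia.
- move=> j y; rewrite mem_rev /neg => /hab h; case: (b j) h => // z h [<-].
  by have [x -> xz] := h _ erefl; exists (- x)%R => //; lia.
- move=> a1 A' e; have : A = rcons (N A') (- a1)%R.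
    by rewrite -[A]NK e /N rev_cons map_rcons.
  move/hAB => [B' [b1 [-> h]]]; exists (- b1)%R, (N B').
  by rewrite Nr; split=> //; lia.
Qed.

(** * Boxes and convex shapes *)

(* [box] hides order-theoretic aliases of [nat] in the types of its projections;
   these wrappers have plain type [nat]. *)
Definition rowb (x : box) : nat := x.1.
Definition colb (x : box) : nat := x.2.
Definition Box (r c : nat) : box := (r, c).

Lemma rowbE r c : rowb (Box r c) = r. Proof. by []. Qed.
Lemma colbE r c : colb (Box r c) = c. Proof. by []. Qed.
Definition rcE := (rowbE, colbE).
Arguments rowb : simpl never.
Arguments colb : simpl never.
Arguments Box : simpl never.

Lemma BoxK x : Box (rowb x) (colb x) = x. Proof. by case: x. Qed.

Lemma box_eqP (x y : box) : rowb x = rowb y -> colb x = colb y -> x = y.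
Proof. by move=> er ec; rewrite -(BoxK x) -(BoxK y) er ec. Qed.

Lemma box_eqE (x y : box) : (x == y) = (rowb x == rowb y) && (colb x == colb y).
Proof. by case: x y => [r c] [r' c']; rewrite -[LHS]/((r, c) == (r', c')) xpair_eqE. Qed.

Lemma box_leE (x y : box) : (x <= y)%O = (rowb x <= rowb y) && (colb x <= colb y).
Proof. by case: x y => [r c] [r' c']; rewrite /= Order.ProdOrder.leEprod. Qed.

Lemma box_lt_sum (x y : box) :
  (x < y)%O = [&& rowb x <= rowb y, colb x <= colb y & rowb x + colb x < rowb y + colb y].
Proof.
rewrite box_ltE -!/(rowb _) -!/(colb _).
by apply/and3P/and3P => -[h1 h2 h3]; split=> //; lia.
Qed.

Definition adj (x y : box) : bool :=
  (rowb x == rowb y) && (colb y == (colb x).+1) ||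
  (rowb y == (rowb x).+1) && (colb x == colb y).

Lemma neighborE x y : neighbor x y = adj x y || adj y x.
Proof.
by rewrite /neighbor /adj -!/(rowb _) -!/(colb _); apply/idP/idP; lia.
Qed.

Lemma adjR r c : adj (Box r c) (Box r c.+1).
Proof. by rewrite /adj !rcE !eqxx. Qed.

Lemma adjD r c : adj (Box r c) (Box r.+1 c).
Proof. by rewrite /adj !rcE !eqxx orbT. Qed.

Definition convex (S : {fset box}) : Prop :=
  forall x y z : box, x \in S -> z \in S -> (x <= y)%O -> (y <= z)%O -> y \in S.

Lemma convex_pred S (x z : box) : convex S -> x \in S -> z \in S -> (x < z)%O ->
  exists2 y, y \in S & adj y z /\ (x <= y)%O.
Proof.
move=> cS xS zS; rewrite box_lt_sum => xz.
have [y [xy yz]] : exists y, (x <= y)%O /\ adj y z.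
  have [h|h] := ltnP (colb x) (colb z).
    by exists (Box (rowb z) (colb z).-1); rewrite box_leE /adj !rcE; split; lia.
  by exists (Box (rowb z).-1 (colb z)); rewrite box_leE /adj !rcE; split; lia.
by exists y => //; apply: cS xS zS xy _; move: yz; rewrite box_leE /adj; lia.
Qed.

Lemma convex_succ S (x z : box) : convex S -> x \in S -> z \in S -> (x < z)%O ->
  exists2 y, y \in S & adj x y /\ (y <= z)%O.
Proof.
move=> cS xS zS; rewrite box_lt_sum => xz.
have [y [xy yz]] : exists y, adj x y /\ (y <= z)%O.
  have [h|h] := ltnP (colb x) (colb z).
    by exists (Box (rowb x) (colb x).+1); rewrite box_leE /adj !rcE; split; lia.
  by exists (Box (rowb x).+1 (colb x)); rewrite box_leE /adj !rcE; split; lia.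
by exists y => //; apply: cS xS zS _ yz; move: xy; rewrite box_leE /adj; lia.
Qed.

Lemma adj_lt x y : adj x y -> (x < y)%O.
Proof. by rewrite box_lt_sum /adj; lia. Qed.

Definition strict (t : box -> option int) : Prop :=
  forall x y a b, adj x y -> t x = Some a -> t y = Some b -> (a < b)%R.

Lemma fnd_mem (V : Type) (T : {fmap box -> V}) x a : T.[? x] = Some a -> x \in domf T.
Proof. by case: fndP. Qed.

Lemma mem_fnd (V : Type) (T : {fmap box -> V}) x :
  x \in domf T -> exists a, T.[? x] = Some a.
Proof. by move=> h; exists T.[h]; rewrite in_fnd. Qed.

(** A convex shape contains a saturated chain between any two of its comparable boxes, so
    inequalities along covers compose. *)
Lemma strict_lt (T : tableau) x y a b : convex (domf T) -> strict (fnd T) ->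
  (x < y)%O -> T.[? x] = Some a -> T.[? y] = Some b -> (a < b)%R.
Proof.
move=> cT sT; move n_def : (rowb y + colb y - rowb x - colb x) => n.
elim: n x y b n_def => [|n IH] x y b nE xy xa yb.
  by move: xy; rewrite box_lt_sum; lia.
have [z zT [zy xz]] := convex_pred cT (fnd_mem xa) (fnd_mem yb) xy.
have [c zc] := mem_fnd zT.
have [e|xz'] := eqVneq x z; first by apply: sT zy _ yb; rewrite -e.
apply: lt_trans (sT _ _ _ _ zy zc yb); apply: IH xa zc; last by rewrite lt_neqAle xz'.
by move: nE xy xz; move: zy; rewrite box_lt_sum box_leE /adj; lia.
Qed.

Definition boxes (m n : nat) : seq box :=
  [seq Box r c | r <- iota 0 m, c <- iota 0 n].

Lemma mem_boxes m n x : (x \in boxes m n) = (rowb x < m) && (colb x < n).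
Proof.
apply/allpairsP/idP => [[[r c] [/= hr hc ->]]|h].
  by move: hr hc; rewrite !mem_iota !rcE; lia.
by exists (rowb x, colb x); rewrite /= !mem_iota BoxK; split=> //; lia.
Qed.

Arguments boxes : simpl never.

Lemma boxes_bounded (s : seq box) :
  exists n, forall x, x \in s -> rowb x < n /\ colb x < n.
Proof.
exists (\max_(x <- s) maxn (rowb x) (colb x)).+1 => x xs.
suff : maxn (rowb x) (colb x) <= \max_(x <- s) maxn (rowb x) (colb x) by lia.
exact: (leq_bigmax_seq (F := fun x => maxn (rowb x) (colb x))).
Qed.

(** The order ideal generated by [S]; the rectangle only makes it a finite set. *)
Definition down (S : {fset box}) : {fset box} :=
  [fset x : box in boxes (\max_(y <- S) rowb y).+1 (\max_(y <- S) colb y).+1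
   | has (fun y => (x <= y)%O) S].

Lemma downP (S : {fset box}) (x : box) :
  reflect (exists2 y : box, y \in S & (x <= y)%O) (x \in down S).
Proof.
rewrite in_fset inE [X in X && _](mem_boxes _ _ x).
apply: (iffP andP) => [[_ /hasP[y]]|[y yS xy]]; first by exists y.
split; last by apply/hasP; exists y.
have h1 : rowb y <= \max_(y <- S) rowb y by apply: (leq_bigmax_seq (F := rowb)).
have h2 : colb y <= \max_(y <- S) colb y by apply: (leq_bigmax_seq (F := colb)).
by move: xy; rewrite box_leE; lia.
Qed.

Lemma down_straight (S : {fset box}) : straight_shape (down S).
Proof.
move=> x y xy /downP[z zS yz]; apply/downP; exists z => //; exact: le_trans yz.
Qed.

Lemma sub_down (S : {fset box}) : S `<=` down S.
Proof. by apply/fsubsetP => x xS; apply/downP; exists x. Qed.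

Lemma skew_convex A nu lam : skew_presentation A nu lam -> convex A.
Proof.
case=> sl sn _ -> x y z; rewrite !inE => /andP[xl xn] /andP[zl zn] xy yz.
by rewrite (sn _ _ yz zn) andbT; apply: contra xl; apply: sl.
Qed.

(** For [A = S] this says that convex sets are skew shapes. For a dotted shape [S] with entries in
    [A], it says that dots at minimal boxes of [S] can be absorbed into the inner shape. *)
Lemma convex_skew (S A : {fset box}) : convex S -> A `<=` S ->
  (forall x y, adj x y -> x \in S -> y \in S -> y \in A) ->
  skew_presentation A (down S) (down S `\` A).
Proof.
move=> cS /fsubsetP AS h; split; first 1 last.
- exact: down_straight.
- exact: fsubsetDl.
- apply/fsetP => x; rewrite !in_fsetD negb_and negbK andb_orl andNb orbF.
  by case xA: (x \in A) => //=; rewrite (fsubsetP (sub_down S)) ?AS.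
move=> x y xy; rewrite !in_fsetD => /andP[yA yS]; rewrite (down_straight xy yS) andbT.
apply: contra yA => xA; have /downP[z zS yz] := yS.
have yS' : y \in S := cS _ _ _ (AS _ xA) zS xy yz.
have [<- //|xy'] := eqVneq x y.
have [|w wS [wy _]] := convex_pred cS (AS _ xA) yS'; first by rewrite lt_neqAle xy'.
exact: h wy wS yS'.
Qed.

Lemma increasingP T : increasing T <-> convex (domf T) /\ strict (fnd T).
Proof.
split=> [[[nu [lam sk]] inc]|[cT sT]].
  split; first exact: skew_convex sk.
  move=> x y a b /adj_lt xy xa yb; have xT := fnd_mem xa; have yT := fnd_mem yb.
  have := inc [` xT] [` yT] xy; rewrite (in_fnd xT) in xa; rewrite (in_fnd yT) in yb.
  by case: xa yb => -> [->].
split; last first.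
  by case=> x xT [y yT] xy; apply: (strict_lt cT sT xy); apply: in_fnd.
exists (down (domf T)), (down (domf T) `\` domf T).
by apply: (convex_skew cT) => //.
Qed.

(** * Slides *)

(* [t0] and [t1] are the fillings before and after a forward slide; [S] is the
   shape of the dotted tableau.  An entry moves by at most one box, and the
   dots are minimal in [S] for [t0] and maximal in [S] for [t1]. *)
Record slide_rel (S : {fset box}) (t0 t1 : box -> option int) : Prop := SlideRel {
  sr_convex : convex S;
  sr_sub0 : forall x a, t0 x = Some a -> x \in S;
  sr_sub1 : forall x a, t1 x = Some a -> x \in S;
  sr_strict0 : strict t0;
  sr_strict1 : strict t1;
  sr_dot0 : forall x y, adj x y -> x \in S -> y \in S -> t0 y <> None;
  sr_dot1 : forall x y, adj x y -> x \in S -> y \in S -> t1 x <> None;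
  sr_le : forall x a b, t0 x = Some a -> t1 x = Some b -> (a <= b)%R;
  sr_le_adj : forall x y a b,
    adj x y -> t1 x = Some a -> t0 y = Some b -> (a <= b)%R;
  sr_del : forall x a, t0 x = Some a ->
    t1 x = Some a \/ exists2 y, adj y x & t1 y = Some a;
  sr_ins : forall x a, t1 x = Some a ->
    t0 x = Some a \/ exists2 y, adj x y & t0 y = Some a }.

(** * Swaps on fillings of a fixed dotted shape *)

Section Stages.
Variable S : {fset box}.
Implicit Types (g h : box -> option int) (v : int).

(** Dotted tableaux of shape [S] are represented by functions on all boxes, so that swaps become
    maps between functions; values outside [S] are irrelevant, which is why later equalities hold on
    [S] only. *)
Definition filling (V : Type) (g : box -> V) : {fmap box -> V} :=
  [fmap x : S => g (val x)].

Lemma fnd_filling (V : Type) (g : box -> V) x :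
  (filling g).[? x] = if x \in S then Some (g x) else None.
Proof.
case: ifP => [xS|/negbT xS]; last by rewrite not_fnd.
by rewrite (in_fnd (xS : x \in domf (filling g))) ffunE.
Qed.

Definition near g x (o : option int) : bool :=
  [exists y : S, neighbor x (val y) && (g (val y) == o)].

Lemma nearP g x o : reflect
  (exists y : box, [/\ y \in S, adj x y || adj y x & g y = o]) (near g x o).
Proof.
apply: (iffP existsP) => [[y]|[y [yS xy gy]]].
  by rewrite neighborE => /andP[xy /eqP gy]; exists (val y); rewrite fsvalP.
by exists [` yS]; rewrite neighborE xy /= gy eqxx.
Qed.

Definition dswap v g (x : box) : option int :=
  if (g x == Some v) && near g x None then None
  else if (g x == None) && near g x (Some v) then Some v else g x.

Lemma swap_filling v g :
  swap (Some v) None (filling g) = filling (dswap v g).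
Proof.
apply/fmapP => x; rewrite fnd_filling; case: ifP => [xS|/negbT xS].
  rewrite (in_fnd (xS : x \in domf (swap _ _ (filling g)))) !ffunE /dswap /near /=.
  have e o : [exists y : domf (filling g),
      neighbor x (val y) && ((filling g) y == o)] =
    [exists y : S, neighbor x (val y) && (g (val y) == o)].
    by apply: eq_existsb => y; rewrite ffunE.
  by rewrite !e.
by rewrite not_fnd.
Qed.

Lemma swap_dots_filling vs g :
  swap_dots vs (filling g) = filling (foldl (fun h v => dswap v h) g vs).
Proof. by elim: vs g => //= v vs IH g; rewrite swap_filling IH. Qed.

Lemma dswap_ext v g h : {in S, g =1 h} -> {in S, dswap v g =1 dswap v h}.
Proof.
move=> gh x xS; rewrite /dswap.
have e o : near g x o = near h x o.
  by apply: eq_existsb => y; rewrite gh ?fsvalP.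
by rewrite !e gh.
Qed.

Lemma foldl_dswap_ext vs g h : {in S, g =1 h} ->
  {in S, foldl (fun h v => dswap v h) g vs =1 foldl (fun h v => dswap v h) h vs}.
Proof. by elim: vs g h => //= v vs IH g h gh; apply/IH/dswap_ext. Qed.

(* A dot is ordered between [v - 1] and [v]. *)
Definition dot_lt v (o o' : option int) : bool :=
  match o, o' with
  | Some a, Some b => (a < b)%R
  | None, Some b => (v <= b)%R
  | Some a, None => (a < v)%R
  | None, None => false
  end.

Definition dot_strict v g : Prop :=
  forall x y, x \in S -> y \in S -> adj x y -> dot_lt v (g x) (g y).

Lemma dot_strict_neq v g x y : dot_strict v g -> x \in S -> y \in S ->
  adj x y || adj y x -> g x <> g y.
Proof.
move=> sg xS yS /orP[] xy e; have := sg _ _ _ _ xy; rewrite e;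
by case: (g y) => [a|] /=; rewrite ?ltxx => /(_ _ _)/implyP; rewrite ?xS ?yS => /(_ isT isT).
Qed.

Lemma dswap_Some v g x a : g x = Some a ->
  dswap v g x = if (a == v) && near g x None then None else Some a.
Proof. by move=> gx; rewrite /dswap gx. Qed.

Lemma dswap_None v g x : g x = None ->
  dswap v g x = if near g x (Some v) then Some v else None.
Proof. by move=> gx; rewrite /dswap gx. Qed.

(** A swapped pair still consists of [v] and a dot, so it is swapped back. No new pair arises,
    because neighbouring boxes never have equal contents. Only this consequence of strictness
    enters, so [w] is independent of [v]; it is used with [v] and with [v + 1]. *)
Lemma dswapK v w g : dot_strict w g -> {in S, dswap v (dswap v g) =1 g}.
Proof.
move=> sg x xS; have neq := dot_strict_neq sg.
case gx: (g x) => [a|].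
- have := dswap_Some v gx; case: ifP => [/andP[/eqP av /nearP[y [yS xy gy]]] e|ne e].
    rewrite (dswap_None _ e) av ifT //; apply/nearP; exists y; split=> //.
    rewrite (dswap_None _ gy) ifT //; apply/nearP; exists x.
    by rewrite orbC gx av.
  rewrite (dswap_Some _ e) ifF //; apply/negbTE/negP => /andP[/eqP av].
  move=> /nearP[y [yS xy]]; case gy: (g y) => [b|].
    rewrite (dswap_Some _ gy); case: ifP => // /andP[/eqP bv _] _.
    by case: (neq _ _ xS yS xy); rewrite gx gy av bv.
  by move: ne; rewrite av eqxx /= => /nearP[]; exists y.
- have := dswap_None v gx; case: ifP => [/nearP[y [yS xy gy]] e|ne e].
    rewrite (dswap_Some _ e) eqxx ifT //; apply/nearP; exists y; split=> //.
    rewrite (dswap_Some _ gy) eqxx ifT //; apply/nearP; exists x.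
    by rewrite orbC gx.
  rewrite (dswap_None _ e) ifF //; apply/negbTE/negP.
  move=> /nearP[y [yS xy]]; case gy: (g y) => [b|].
    rewrite (dswap_Some _ gy); case: ifP => // _ [bv].
    by move: ne => /nearP[]; exists y; rewrite gy bv.
  by case: (neq _ _ xS yS xy); rewrite gx gy.
Qed.

Lemma near_adj g x y : x \in S -> y \in S -> adj x y ->
  near g x (g y) /\ near g y (g x).
Proof.
move=> xS yS xy; split; apply/nearP.
  by exists y; rewrite xy.
by exists x; rewrite xy orbT.
Qed.

(** Moving the dots from just below [v] to just above it affects only comparisons of a dot with the
    value [v], and such adjacent pairs are exactly the ones exchanged. *)
Lemma dswap_strictS v g : dot_strict v g -> dot_strict (v + 1)%R (dswap v g).
Proof.
move=> sg x y xS yS xy; have := sg x y xS yS xy; have [] := near_adj g xS yS xy.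
case gx: (g x) => [a|]; case gy: (g y) => [b|] //= nx ny h.
- rewrite (dswap_Some _ gx) (dswap_Some _ gy).
  by do 2!case: ifP => ? /=; lia.
- by rewrite (dswap_Some _ gx) (dswap_None _ gy); do 2!case: ifP => ? /=; lia.
- rewrite (dswap_None _ gx) (dswap_Some _ gy) ny andbT.
  have [e|e] := eqVneq b v; first by rewrite -e nx /=; lia.
  by case: ifP => ? /=; lia.
Qed.

Lemma dswap_strictP v g : dot_strict (v + 1)%R g -> dot_strict v (dswap v g).
Proof.
move=> sg x y xS yS xy; have := sg x y xS yS xy; have [] := near_adj g xS yS xy.
case gx: (g x) => [a|]; case gy: (g y) => [b|] //= nx ny h.
- rewrite (dswap_Some _ gx) (dswap_Some _ gy).
  by do 2!case: ifP => ? /=; lia.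
- rewrite (dswap_Some _ gx) (dswap_None _ gy) nx andbT.
  have [e|e] := eqVneq a v; first by rewrite -e ny /=; lia.
  by case: ifP => ? /=; lia.
- by rewrite (dswap_None _ gx) (dswap_Some _ gy); do 2!case: ifP => ? /=; lia.
Qed.

End Stages.

(** * Slides as runs of swaps *)

Section Runs.
Variable S : {fset box}.
Implicit Types (g h t : box -> option int) (v a : int).

Lemma dswap_neq v u g x : u <> v -> dswap S v g x = Some u <-> g x = Some u.
Proof.
move=> uv; case gx: (g x) => [a|].
  rewrite (dswap_Some S v gx); case: ifP => [/andP[/eqP -> _]|//].
  by split=> // -[e]; case: uv.
by rewrite (dswap_None S v gx); case: ifP => // _; split=> // -[e]; case: uv.
Qed.

Lemma dswap_eq v g x : dswap S v g x = Some v ->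
  g x = Some v \/ g x = None /\ near S g x (Some v).
Proof.
case gx: (g x) => [a|].
  by rewrite (dswap_Some S v gx); case: ifP => // _ [->]; left.
by rewrite (dswap_None S v gx); case: ifP => // nx _; right.
Qed.

Lemma near_dot v g x : dot_strict S v g -> x \in S -> g x = Some v ->
  near S g x None -> exists2 y, y \in S & adj y x /\ g y = None.
Proof.
move=> sg xS gx /nearP[y [yS /orP[xy|yx] gy]]; last by exists y.
by have := sg _ _ xS yS xy; rewrite gx gy /= ltxx.
Qed.

Lemma near_value v g x : dot_strict S v g -> x \in S -> g x = None ->
  near S g x (Some v) -> exists2 y, y \in S & adj x y /\ g y = Some v.
Proof.
move=> sg xS gx /nearP[y [yS /orP[xy|yx] gy]]; first by exists y.
by have := sg _ _ yS xS yx; rewrite gx gy /= ltxx.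
Qed.

(** Invariant of a forward slide of [t] just before the swap of [v]. Values from [v] on have not
    moved ([st_high]); the other clauses become fields of [slide_rel] once the range is
    exhausted. *)
Record stage t v g : Prop := Stage {
  st_strict : dot_strict S v g;
  st_high : forall x u, x \in S -> (v <= u)%R -> (g x = Some u <-> t x = Some u);
  st_del : forall x u, x \in S -> t x = Some u ->
    g x = Some u \/ exists2 y, y \in S & adj y x /\ g y = Some u;
  st_ins : forall x u, x \in S -> g x = Some u ->
    t x = Some u \/ exists2 y, y \in S & adj x y /\ t y = Some u;
  st_le : forall x a b, x \in S -> t x = Some a -> g x = Some b -> (a <= b)%R;
  st_le_adj : forall x y a b, x \in S -> y \in S ->
    adj x y -> g x = Some a -> t y = Some b -> (a <= b)%R }.

(** By [st_high] the entries [v] are still where [t] has them, and by [dot_strict] a dot next to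
    such an entry precedes it. Each value thus moves only in its own swap, by at most one box and
    towards the origin. *)
Lemma stageS t v g : stage t v g -> stage t (v + 1)%R (dswap S v g).
Proof.
case=> sg high del ins le le_adj; split; first exact: dswap_strictS.
- by move=> x u xS vu; rewrite dswap_neq; [apply: high|]; lia.
- move=> x u xS tx; have [uv|/eqP uv] := eqVneq u v; last first.
    have [gx|[y yS [yx gy]]] := del x u xS tx; first by left; apply/dswap_neq.
    by right; exists y => //; split=> //; apply/dswap_neq.
  have gx : g x = Some v by apply/high => //; rewrite -uv.
  rewrite uv (dswap_Some S v gx) eqxx /=; case: ifP => [nx|]; last by left.
  have [y yS [yx gy]] := near_dot sg xS gx nx.
  right; exists y => //; split=> //; rewrite (dswap_None S v gy) ifT //.
  by apply/nearP; exists x; rewrite yx.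
- move=> x u xS; have [->|/eqP uv] := eqVneq u v; last first.
    by move/(dswap_neq _ _ uv); apply: ins.
  case/dswap_eq => [|[gx nx]]; first exact: ins.
  have [y yS [xy gy]] := near_value sg xS gx nx.
  by right; exists y => //; split=> //; apply/high.
- move=> x c b xS tx; have [->|/eqP bv] := eqVneq b v; last first.
    by move/(dswap_neq _ _ bv); apply: le.
  case/dswap_eq => [|[gx _]]; first exact: le.
  rewrite leNgt; apply/negP => vc.
  by have := proj2 (high x c xS (ltW vc)) tx; rewrite gx.
- move=> x y c b xS yS xy; have [->|/eqP cv] := eqVneq c v; last first.
    by move/(dswap_neq _ _ cv); apply: le_adj.
  case/dswap_eq => [|[gx _]]; first exact: le_adj.
  have := sg x y xS yS xy; rewrite gx; case gy: (g y) => [d|] //= vd.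
  by rewrite (proj1 (high y d yS vd) gy) => -[<-].
Qed.

Definition vals a n : seq int := [seq (a + k%:Z)%R | k <- iota 0 n].

Lemma valsS a n : vals a n.+1 = rcons (vals a n) (a + n%:Z)%R.
Proof. by rewrite /vals -addn1 iotaD map_cat cats1. Qed.

Definition run g vs := foldl (fun h v => dswap S v h) g vs.

Lemma run_rcons g vs v : run g (rcons vs v) = dswap S v (run g vs).
Proof. by rewrite /run -cats1 foldl_cat. Qed.

Lemma stage_run t a n : dot_strict S a t -> stage t (a + n%:Z)%R (run t (vals a n)).
Proof.
move=> st; elim: n => [|n IH]; last first.
  by rewrite valsS run_rcons (_ : (a + n.+1%:Z = a + n%:Z + 1)%R); [apply: stageS|lia].
rewrite addr0; split=> //=.
- by move=> x u xS ->; left.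
- by move=> x u xS ->; left.
- by move=> x c b _ -> [->].
- by move=> x y c b xS yS xy tx ty; have := st x y xS yS xy; rewrite tx ty => /ltW.
Qed.

Lemma run_value g vs x u : run g vs x = Some u -> u \in vs \/ exists y, g y = Some u.
Proof.
elim: vs g x => [|v vs IH] g x /=; first by right; exists x.
case/IH => [h|[y]]; first by left; rewrite inE h orbT.
have [->|/eqP uv] := eqVneq u v; first by left; rewrite inE eqxx.
by move/(dswap_neq _ _ uv); right; exists y.
Qed.

Lemma mem_vals a n u : (u \in vals a n) = (a <= u < a + n%:Z)%R.
Proof.
apply/mapP/idP => [[k]|h]; first by rewrite mem_iota => ? ->; lia.
by exists `|u - a|%N; [rewrite mem_iota|]; lia.
Qed.

(** At the start a dot is smaller than every entry, hence has no predecessor in [S]; at the end it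
    is larger than every entry, hence has no successor. This gives [sr_dot0] and [sr_dot1]. *)
Lemma slide_rel_run t t' a n : convex S ->
  (forall x u, t x = Some u -> x \in S) ->
  (forall x u, t x = Some u -> (a <= u < a + n%:Z)%R) ->
  dot_strict S a t ->
  (forall x, t' x = if x \in S then run t (vals a n) x else None) ->
  slide_rel S t t'.
Proof.
move=> cS tS tv st t'E; have [sg high del ins le le_adj] := stage_run n st.
have t'S x u : t' x = Some u -> x \in S by rewrite t'E; case: ifP.
have t'E' x : x \in S -> t' x = run t (vals a n) x by rewrite t'E => ->.
split=> //.
- move=> x y c b xy tx ty; have := st x y (tS _ _ tx) (tS _ _ ty) xy.
  by rewrite tx ty.
- move=> x y c b xy tx ty; have xS := t'S _ _ tx; have yS := t'S _ _ ty.
  by move: tx ty (sg x y xS yS xy); rewrite !t'E' // => -> ->.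
- move=> x y xy xS yS ty; have := st x y xS yS xy; rewrite ty.
  by case tx: (t x) => [u|] //=; have := tv _ _ tx; lia.
- move=> x y xy xS yS; rewrite t'E' // => gx; have := sg x y xS yS xy; rewrite gx.
  case gy: (run t _ y) => [b|] //= ab.
  by have := tv _ _ (proj1 (high y b yS ab) gy); lia.
- by move=> x c b tx; rewrite t'E' ?(tS _ _ tx) //; apply: le (tS _ _ tx) tx.
- move=> x y c b xy gx ty; have xS := t'S _ _ gx; move: gx; rewrite t'E' // => gx.
  exact: (le_adj x y) (tS _ _ ty) xy gx ty.
- move=> x c tx; have xS := tS _ _ tx; rewrite t'E' //.
  have [|[y yS [yx gy]]] := del x c xS tx; first by left.
  by right; exists y; rewrite // t'E'.
- move=> x c gx; have xS := t'S _ _ gx; move: gx; rewrite t'E' // => gx.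
  have [|[y yS [xy ty]]] := ins x c xS gx; first by left.
  by right; exists y.
Qed.

Lemma run_ext g h vs : {in S, g =1 h} -> {in S, run g vs =1 run h vs}.
Proof. exact: foldl_dswap_ext. Qed.

(** Every swap undoes itself by [dswapK], so running up the range recovers [g]. A reverse slide can
    thus be analysed as a forward slide that starts at its result. *)
Lemma run_revK g a n : dot_strict S (a + n%:Z)%R g ->
  let h := run g (rev (vals a n)) in
  dot_strict S a h /\ {in S, run h (vals a n) =1 g}.
Proof.
elim: n g => [|n IH] g; first by rewrite addr0.
rewrite valsS rev_rcons => sg h.
have sg' : dot_strict S (a + n%:Z + 1)%R g.
  by rewrite (_ : (a + n%:Z + 1 = a + n.+1%:Z)%R) //; lia.
have [sh hK] := IH _ (dswap_strictP sg'); split=> // x xS; rewrite /h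
  run_rcons (dswap_ext _ hK) //; exact: dswapK sg x xS.
Qed.

Lemma fnd_delete_dots g x :
  (delete_dots (filling S g)).[? x] = if x \in S then g x else None.
Proof. by rewrite /delete_dots fnd_reducef fnd_filling; case: ifP. Qed.

End Runs.

Lemma int_rangeE a b : exists n, int_range a b = vals a n /\
  forall u, (a <= u <= b)%R = (a <= u < a + n%:Z)%R.
Proof.
rewrite /int_range; case: ifP => ab.
  by exists (`|b - a|%N.+1); split=> // u; apply/idP/idP; lia.
by exists 0; split=> // u; apply/idP/idP; lia.
Qed.

Lemma add_dotsE (T : tableau) C :
  add_dots T C = filling (domf T `|` C) (fnd T).
Proof. by []. Qed.

Lemma forward_slide_rel (T : tableau) nu lam C a b :
  increasing T -> skew_presentation (domf T) nu lam -> values_in a b T ->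
  (forall x, x \in C -> maximal_in lam x) ->
  slide_rel (domf T `|` C) (fnd T) (fnd (forward_slide a b C T)).
Proof.
move=> /increasingP[cT sT] sk vT maxC.
have [n [rgE rE]] := int_rangeE a b.
have [sl sn ln dT] := sk.
have CT x : x \in C -> x \notin domf T.
  by case/maxC => xl _; rewrite dT in_fsetD xl.
have noS x y : adj x y -> x \in domf T `|` C -> y \in C -> False.
  move=> xy xS yC; have [yl _] := maxC y yC.
  have xl : x \in lam by apply: sl yl; apply/ltW/adj_lt.
  move: xS; rewrite in_fsetU dT in_fsetD xl /= => /maxC[_ mx].
  have := adj_lt xy; rewrite (mx y yl) ?ltxx //; exact/ltW/adj_lt.
have Tv x u : T.[? x] = Some u -> (a <= u < a + n%:Z)%R.
  move=> xu; have xT := fnd_mem xu; rewrite -rE.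
  by have := vT [` xT]; move: xu; rewrite (in_fnd xT) => -[->].
apply: (@slide_rel_run _ _ _ a n); last first.
- by move=> x; rewrite /forward_slide add_dotsE swap_dots_filling rgE fnd_delete_dots.
- move=> x y xS yS xy.
  have yT : y \in domf T.
    by move: yS; rewrite in_fsetU => /orP[//|/(noS _ _ xy xS)].
  have [v ty] := mem_fnd yT; rewrite ty.
  case tx: T.[? x] => [u|] /=; first exact: sT xy tx ty.
  by have := Tv _ _ ty; lia.
- exact: Tv.
- by move=> x u tx; rewrite in_fsetU (fnd_mem tx).
- have -> : domf T `|` C = nu `\` (lam `\` C).
    apply/fsetP => x; rewrite dT in_fsetU !in_fsetD.
    case xC: (x \in C); last by rewrite orbF.
    by have [xl _] := maxC x xC; rewrite xl (fsubsetP ln).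
  apply: (@skew_convex _ nu (lam `\` C)); split=> //.
    move=> x y xy; rewrite !in_fsetD => /andP[yC yl]; rewrite (sl _ _ xy yl) andbT.
    apply: contra yC => xC; have [_ mx] := maxC x xC.
    by rewrite (mx y yl xy).
  by apply: fsubset_trans ln; exact: fsubsetDl.
Qed.

Lemma reverse_slide_rel (T : tableau) nu lam C a b :
  increasing T -> skew_presentation (domf T) nu lam -> values_in a b T ->
  (forall x, x \in C -> minimal_outside nu x) ->
  slide_rel (domf T `|` C) (fnd (reverse_slide a b C T)) (fnd T).
Proof.
move=> /increasingP[cT sT] sk vT minC.
have [n [rgE rE]] := int_rangeE a b.
have [sl sn ln dT] := sk.
set S := domf T `|` C; set T' := reverse_slide a b C T.
have CT x : x \in C -> x \notin domf T.
  by case/minC => xn _; rewrite dT in_fsetD negb_and xn orbT.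
have noS x y : adj x y -> x \in C -> y \in S -> False.
  move=> xy xC yS; have [xn mx] := minC x xC.
  have xley := ltW (adj_lt xy).
  have yn : y \notin nu by apply: contra xn; apply: sn.
  move: yS; rewrite in_fsetU dT in_fsetD (negbTE yn) andbF /= => yC.
  have [_ my] := minC y yC; have := adj_lt xy.
  by rewrite -(my x xn xley) ltxx.
have Tv x u : T.[? x] = Some u -> (a <= u < a + n%:Z)%R.
  move=> xu; have xT := fnd_mem xu; rewrite -rE.
  by have := vT [` xT]; move: xu; rewrite (in_fnd xT) => -[->].
have T'E x : T'.[? x] =
    if x \in S then run S (fnd T) (rev (vals a n)) x else None.
  by rewrite /T' /reverse_slide add_dotsE swap_dots_filling rgE fnd_delete_dots.
have sg : dot_strict S (a + n%:Z)%R (fnd T).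
  move=> x y xS yS xy.
  have xT : x \in domf T.
    by move: xS; rewrite in_fsetU => /orP[//|xC]; case: (noS _ _ xy xC yS).
  have [v tx] := mem_fnd xT; rewrite tx.
  case ty: T.[? y] => [u|] /=; first exact: sT xy tx ty.
  by have := Tv _ _ tx; lia.
have [sh hK] := run_revK sg.
have hT' : {in S, fnd T' =1 run S (fnd T) (rev (vals a n))}.
  by move=> x xS; rewrite T'E xS.
apply: (@slide_rel_run _ _ _ a n).
- have -> : S = (nu `|` C) `\` lam.
    apply/fsetP => x; rewrite /S dT in_fsetU !in_fsetD in_fsetU.
    case xC: (x \in C); last by rewrite !orbF.
    have [xn _] := minC x xC; rewrite !orbT andbT.
    by apply/esym/negP => /(fsubsetP ln); apply/negP.
  apply: (@skew_convex _ (nu `|` C) lam); split=> //; last first.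
    by apply: fsubset_trans ln _; exact: fsubsetUl.
  move=> x y xy; rewrite !in_fsetU => /orP[yn|yC]; first by rewrite (sn _ _ xy yn).
  case xn: (x \in nu) => //=; have [_ my] := minC y yC.
  by rewrite (my x) ?xn.
- by move=> x u; rewrite T'E; case: ifP.
- move=> x u; rewrite T'E; case: ifP => // _ /run_value[|[y /Tv //]].
  by rewrite mem_rev mem_vals.
- by move=> x y xS yS xy; rewrite !hT' //; apply: sh.
- move=> x; case: ifP => [xS|/negbT xS]; last first.
    by rewrite not_fnd //; apply: contra xS; rewrite in_fsetU => ->.
  by rewrite (run_ext _ hT') // hK.
Qed.

Lemma slide_step_rel T T' : slide_step T T' ->
  exists S, slide_rel S (fnd T) (fnd T') \/ slide_rel S (fnd T') (fnd T).
Proof.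
case=> [nu lam C a b iT sk vT hC|nu lam C a b iT sk vT hC].
  by exists (domf T `|` C); left; apply: forward_slide_rel sk vT hC.
by exists (domf T `|` C); right; apply: reverse_slide_rel sk vT hC.
Qed.

(** * Recovering the swaps from the relation *)

Section SlideRelSteps.
Variables (S : {fset box}) (t0 t1 : box -> option int).
Hypothesis sr : slide_rel S t0 t1.

(* The dotted tableau just before the swap of [v] with the dots. *)
Definition mixed (v : int) (x : box) : option int :=
  if t1 x is Some b then
    if (b < v)%R then Some b
    else if t0 x is Some a then if (v <= a)%R then Some a else None else None
  else if t0 x is Some a then if (v <= a)%R then Some a else None else None.

Lemma mixed_strict v : dot_strict S v (mixed v).
Proof.
have [_ _ _ s0 s1 d0 d1 le le_adj _ _] := sr.
move=> x y xS yS xy; have := d0 x y xy xS yS; have := d1 x y xy xS yS.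
rewrite /mixed; case ax: (t1 x) => [a|] // _; case dy: (t0 y) => [d|] // _.
have ad := le_adj _ _ _ _ xy ax dy.
case bx: (t0 x) => [b|]; case cy: (t1 y) => [c|].
- have ab := le _ _ _ bx ax; have dc := le _ _ _ dy cy.
  have bd := s0 _ _ _ _ xy bx dy; have ac := s1 _ _ _ _ xy ax cy.
  by do ![case: ifP => ? /=]; lia.
- have ab := le _ _ _ bx ax; have bd := s0 _ _ _ _ xy bx dy.
  by do ![case: ifP => ? /=]; lia.
- have dc := le _ _ _ dy cy; have ac := s1 _ _ _ _ xy ax cy.
  by do ![case: ifP => ? /=]; lia.
- by do ![case: ifP => ? /=]; lia.
Qed.

Lemma mixedP v x o : mixed v x = o ->
  match o with
  | Some u => (t1 x = Some u /\ (u < v)%R) \/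
              [/\ t0 x = Some u, (v <= u)%R & forall b, t1 x = Some b -> (v <= b)%R]
  | None => (forall b, t1 x = Some b -> (v <= b)%R) /\
            (forall a, t0 x = Some a -> (a < v)%R)
  end.
Proof.
move=> <-; rewrite /mixed; case: (t1 x) => [b|]; case: (t0 x) => [a|] //;
  try (case: ifP => bv; first by left); try case: ifP => av; try right;
  by split=> // ? -[<-]; lia.
Qed.

Lemma mixed1 v x u : t1 x = Some u -> (u < v)%R -> mixed v x = Some u.
Proof. by rewrite /mixed => -> ->. Qed.

Lemma mixed0 v x u : t0 x = Some u -> (v <= u)%R -> mixed v x = Some u.
Proof.
have le := sr_le sr; move=> tx vu; rewrite /mixed tx vu.
by case e: (t1 x) => [b|] //; have := le _ _ _ tx e; case: ifP => //; lia.
Qed.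

Lemma mixedN v x :
  (forall b, t1 x = Some b -> (v <= b)%R) ->
  (forall a, t0 x = Some a -> (a < v)%R) -> mixed v x = None.
Proof.
rewrite /mixed => h1 h0.
case: (t1 x) h1 => [b /(_ _ erefl) vb|_]; [rewrite ltNge vb /=|];
by case: (t0 x) h0 => [a /(_ _ erefl)|//]; rewrite ltNge; case: (_ <= _)%R.
Qed.

(** An entry [v] that keeps its box has no dot before it: a preceding box of [S] has a new entry by
    [sr_dot1], which is below [v] and so already in place. An entry [v] that moves goes to a
    preceding box by [sr_del], and this box is a dot at stage [v]. Conversely, a dot that has to
    become [v] finds the entry [v] behind it by [sr_ins]. *)
Lemma dswap_mixed v : {in S, dswap S v (mixed v) =1 mixed (v + 1)%R}.
Proof.
have [_ sub0 sub1 s0 s1 d0 d1 le le_adj del ins] := sr.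
have ms := @mixed_strict v; move=> x xS.
case mx: (mixed v x) => [a|].
- have [av|/eqP av] := eqVneq a v; last first.
    rewrite (dswap_Some S v mx); case: ifP => [/andP[/eqP]//|_].
    have [[tx av']|[tx va h]] := mixedP mx; apply/esym.
      by apply: mixed1 => //; lia.
    by apply: mixed0 => //; lia.
  rewrite {}av in mx; rewrite (dswap_Some S v mx) eqxx /=.
  have [[_]|[tx _ h]] := mixedP mx; first by rewrite ltxx.
  have [t1x|/eqP t1x] := eqVneq (t1 x) (Some v).
    rewrite ifF; first by rewrite (mixed1 t1x) //; lia.
    apply/negbTE/negP => nx; have [y yS [yx my]] := near_dot ms xS mx nx.
    have [hy _] := mixedP my.
    case ty: (t1 y) (d1 _ _ yx yS xS) => [u|//] _.
    by have := s1 _ _ _ _ yx ty t1x; have := hy _ ty; lia.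
  have [//|[y yx ty]] := del _ _ tx.
  rewrite ifT; last first.
    apply/nearP; exists y; split; rewrite ?yx ?orbT ?(sub1 _ _ ty) //.
    apply: mixedN => [b|b ty0]; first by rewrite ty => -[->].
    exact: s0 yx ty0 tx.
  apply/esym/mixedN => [b e|b]; last by rewrite tx => -[<-]; lia.
  by have := h _ e; rewrite le_eqVlt => /orP[/eqP e'|]; [rewrite e e' in t1x|lia].
- rewrite (dswap_None S v mx); have [h1 h0] := mixedP mx.
  case: ifP => nx; apply/esym.
    have [y yS [xy my]] := near_value ms xS mx nx.
    have [[_]|[ty _ _]] := mixedP my; first by rewrite ltxx.
    case t1x: (t1 x) (d1 _ _ xy xS yS) => [u|//] _.
    have := le_adj _ _ _ _ xy t1x ty; have := h1 _ t1x => vu uv.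
    by apply: mixed1; [rewrite t1x; congr Some|]; lia.
  apply: mixedN => [b t1x|b /h0]; last by lia.
  have := h1 _ t1x; rewrite le_eqVlt => /orP[/eqP vb|]; last by lia.
  have [/h0|[y xy ty]] := ins _ _ t1x; first by lia.
  move: nx => /nearP[]; exists y; split; rewrite ?xy ?(sub0 _ _ ty) //.
  by apply: mixed0; rewrite vb.
Qed.

Lemma run_mixed a n : {in S, run S (mixed a) (vals a n) =1 mixed (a + n%:Z)%R}.
Proof.
elim: n => [|n IH] x xS; first by rewrite addr0.
rewrite valsS run_rcons (dswap_ext _ IH) // dswap_mixed //.
by rewrite (_ : (a + n%:Z + 1 = a + n.+1%:Z)%R) //; lia.
Qed.

Lemma run_rev_mixed a n :
  {in S, run S (mixed (a + n%:Z)%R) (rev (vals a n)) =1 mixed a}.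
Proof.
elim: n => [|n IH] x xS; first by rewrite addr0.
rewrite valsS rev_rcons -IH //.
apply: (@run_ext _ (dswap S (a + n%:Z)%R (mixed (a + n.+1%:Z)%R))) xS => y yS.
rewrite -(dswapK (a + n%:Z)%R (@mixed_strict (a + n%:Z)%R) yS).
apply: dswap_ext yS => z zS; rewrite dswap_mixed //.
by rewrite (_ : (a + n%:Z + 1 = a + n.+1%:Z)%R) //; lia.
Qed.

Lemma mixed_low a : (forall x u, t0 x = Some u -> (a <= u)%R) -> mixed a =1 t0.
Proof.
have [_ _ _ _ _ _ _ le _ _ ins] := sr; move=> h x.
case tx: (t0 x) => [u|]; first by apply: mixed0 (h _ _ tx).
apply: mixedN => [b t1x|b]; last by rewrite tx.
by have [/h //|[y _ /h]] := ins _ _ t1x.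
Qed.

Lemma mixed_high a : (forall x u, t1 x = Some u -> (u < a)%R) -> mixed a =1 t1.
Proof.
have [_ _ _ _ _ _ _ le _ del _] := sr; move=> h x.
case tx: (t1 x) => [u|]; first by apply: mixed1 (h _ _ tx).
apply: mixedN => [b|b t0x]; first by rewrite tx.
by have [/h //|[y _ /h]] := del _ _ t0x.
Qed.

End SlideRelSteps.

Lemma tableau_bounded (T : tableau) :
  exists m : nat, forall x u, T.[? x] = Some u -> (`|u| <= m)%N.
Proof.
exists (\max_(x : domf T) `|T x|%N) => x u xu.
have xT := fnd_mem xu; move: xu; rewrite (in_fnd xT) => -[<-].
exact: (@leq_bigmax _ (fun x : domf T => `|T x|%N)).
Qed.

Section SlideRelTableau.
Variables (S : {fset box}) (T0 T1 : tableau).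
Hypothesis sr : slide_rel S (fnd T0) (fnd T1).

Lemma slide_rel_sub0 : domf T0 `<=` S.
Proof. by apply/fsubsetP => x /mem_fnd[u]; apply: (sr_sub0 sr). Qed.

Lemma slide_rel_sub1 : domf T1 `<=` S.
Proof. by apply/fsubsetP => x /mem_fnd[u]; apply: (sr_sub1 sr). Qed.

Lemma slide_rel_skew0 :
  skew_presentation (domf T0) (down S) (down S `\` domf T0).
Proof.
apply: convex_skew (sr_convex sr) slide_rel_sub0 _ => x y xy xS yS.
by have := sr_dot0 sr xy xS yS; case: fndP.
Qed.

Lemma slide_rel_skew1 :
  skew_presentation (domf T1) (down S `\` (S `\` domf T1)) (down S `\` S).
Proof.
have cS := sr_convex sr; have /fsubsetP sub1 := slide_rel_sub1.
have /fsubsetP subS := sub_down S.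
split.
- move=> x y xy; rewrite !in_fsetD => /andP[yS yd].
  rewrite (down_straight xy yd) andbT; apply: contra yS => xS.
  by have /downP[z zS yz] := yd; apply: cS xy yz.
- move=> x y xy; rewrite !in_fsetD negb_and negbK => /andP[yn yd].
  rewrite (down_straight xy yd) andbT negb_and negbK orbC -implybE.
  apply/implyP => xS; have /downP[z zS yz] := yd.
  have yS := cS _ _ _ xS zS xy yz.
  have yT : y \in domf T1 by move: yn; rewrite yS orbF.
  have [-> //|xy'] := eqVneq x y.
  have [|w wS [xw _]] := convex_succ cS xS yS; first by rewrite lt_neqAle xy'.
  by have := sr_dot1 sr xw xS wS; case: fndP.
- by apply: fsetDS; apply: fsubsetDl.
- apply/fsetP => x; rewrite !in_fsetD !negb_and !negbK.
  case xT: (x \in domf T1) => /=; first by rewrite (sub1 _ xT) subS ?sub1.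
  by case: (x \in S); rewrite ?andbF //= andNb.
Qed.

Lemma slide_rel_increasing0 : increasing T0.
Proof.
apply/increasingP; split; last exact: sr_strict0 sr.
exact: skew_convex slide_rel_skew0.
Qed.

Lemma slide_rel_increasing1 : increasing T1.
Proof.
apply/increasingP; split; last exact: sr_strict1 sr.
exact: skew_convex slide_rel_skew1.
Qed.

Lemma slide_rel_step : slide_step T0 T1 /\ slide_step T1 T0.
Proof.
have cS := sr_convex sr.
have /fsubsetP sub0 := slide_rel_sub0; have /fsubsetP sub1 := slide_rel_sub1.
have [m0 b0] := tableau_bounded T0; have [m1 b1] := tableau_bounded T1.
pose m := maxn m0 m1.
(* The range contains all entries of both fillings, so [mixed] is [T0] at its lower end and [T1]
   past its upper end. *)
have [n [rgE rE]] := int_rangeE (- m%:Z)%R m%:Z.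
have v0 : values_in (- m%:Z)%R m%:Z T0.
  by case=> x xT; have := b0 _ _ (in_fnd xT); rewrite /m; lia.
have v1 : values_in (- m%:Z)%R m%:Z T1.
  by case=> x xT; have := b1 _ _ (in_fnd xT); rewrite /m; lia.
have low : mixed (fnd T0) (fnd T1) (- m%:Z)%R =1 fnd T0.
  by apply: (mixed_low sr) => x u /b0; rewrite /m; lia.
have high : mixed (fnd T0) (fnd T1) (- m%:Z + n%:Z)%R =1 fnd T1.
  apply: (mixed_high sr) => x u /b1 um.
  by have := rE u; rewrite /m in rE *; lia.
have dotsE (T : tableau) : {subset domf T <= S} ->
    add_dots T (S `\` domf T) = filling S (fnd T).
  move=> sub; rewrite add_dotsE.
  suff -> : domf T `|` (S `\` domf T) = S by [].
  apply/fsetP => x; rewrite in_fsetU in_fsetD.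
  by case xT: (x \in domf T) => //=; rewrite sub.
split.
- have -> : T1 = forward_slide (- m%:Z)%R m%:Z (S `\` domf T0) T0.
    apply/fmapP => x; rewrite /forward_slide dotsE // rgE swap_dots_filling.
    rewrite fnd_delete_dots -/(run _ _ _); case: ifP => xS.
      rewrite -high -(run_mixed sr) //; apply: run_ext xS => y yS; exact: low.
    by rewrite not_fnd //; apply/negP => /sub1; rewrite xS.
  apply: ForwardSlide slide_rel_increasing0 slide_rel_skew0 v0 _ => x.
  rewrite in_fsetD => /andP[xT xS]; split.
    by rewrite in_fsetD xT (fsubsetP (sub_down S)).
  move=> y; rewrite in_fsetD => /andP[yT yd] xy; have /downP[z zS yz] := yd.
  have yS := cS _ _ _ xS zS xy yz.
  apply/eqP; apply: contraNT yT => yx.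
  have [|w wS [wy _]] := convex_pred cS xS yS; first by rewrite lt_neqAle eq_sym yx.
  by have := sr_dot0 sr wy wS yS; case: fndP.
- have -> : T0 = reverse_slide (- m%:Z)%R m%:Z (S `\` domf T1) T1.
    apply/fmapP => x; rewrite /reverse_slide dotsE // rgE swap_dots_filling.
    rewrite fnd_delete_dots -/(run _ _ _); case: ifP => xS.
      rewrite -low -(run_rev_mixed sr _ n) //; apply: run_ext xS => y yS; exact: high.
    by rewrite not_fnd //; apply/negP => /sub0; rewrite xS.
  apply: ReverseSlide slide_rel_increasing1 slide_rel_skew1 v1 _ => x.
  rewrite in_fsetD => /andP[xT xS]; split.
    by rewrite !in_fsetD xT xS.
  move=> y; rewrite !in_fsetD negb_and negbK => yn yx.
  have yd : y \in down S by apply: down_straight yx _; apply: (fsubsetP (sub_down S)).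
  move: yn; rewrite yd orbF => /andP[yT yS].
  apply/eqP; apply: contraNT yT => yx'.
  have [|w wS [yw _]] := convex_succ cS yS xS; first by rewrite lt_neqAle yx'.
  by have := sr_dot1 sr yw yS wS; case: fndP.
Qed.

End SlideRelTableau.

(** * Reading words *)

(** If this holds for distinct boxes, [y] has to be read before [x]. *)
Definition north_east (x y : box) : bool :=
  (rowb x <= rowb y) && (colb y <= colb x).

(** The order condition on readings without reference to a shape, so that it passes to prefixes and
    filtered lists. As [north_east] is reflexive, repetitions are excluded as well. *)
Definition linear (s : seq box) : bool :=
  pairwise (fun x y => ~~ north_east x y) s.

Lemma linear_uniq s : linear s -> uniq s.
Proof.
rewrite uniq_pairwise; apply: sub_pairwise => x y.
by apply: contraNneq => ->; rewrite /north_east !leqnn.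
Qed.

Lemma linear_rcons s x :
  linear (rcons s x) = all (fun y => ~~ north_east y x) s && linear s.
Proof. exact: pairwise_rcons. Qed.

Lemma linear_filter a s : linear s -> linear (filter a s).
Proof. exact: subseq_pairwise (filter_subseq _ _). Qed.

Lemma reading_order_linear A s : reading_order A s -> linear s.
Proof.
case=> us sA ord; apply/(pairwiseP (Box 0 0)) => i j; rewrite !inE => hi hj ij.
apply/negP => /andP[h1 h2].
have := ord (nth (Box 0 0) s j) (nth (Box 0 0) s i).
rewrite -!sA !mem_nth // !index_uniq // nth_uniq // => /(_ isT isT) h.
suff : j < i by lia.
by apply: h => //; rewrite neq_ltn ij.
Qed.

Section ReadingWords.
Variable T : tableau.
Hypothesis iT : increasing T.

Definition read (s : seq box) : seq int := pmap (fun x => T.[? x]) s.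

Lemma read_rcons s x u : T.[? x] = Some u -> read (rcons s x) = rcons (read s) u.
Proof. by move=> xu; rewrite /read -cats1 pmap_cat /= xu /= cats1. Qed.

(** Together with [linear], this describes the initial segments of reading orders of [T]. *)
Definition south_west_closed (s : seq box) : Prop :=
  {subset s <= domf T} /\
  forall x y, x \in s -> y \in domf T -> north_east x y -> y \in s.

Lemma closed_rem s x : south_west_closed (rcons s x) -> linear (rcons s x) ->
  south_west_closed s.
Proof.
move=> [sub cl]; rewrite linear_rcons => /andP[/allP mx _]; split.
  by move=> y ys; apply: sub; rewrite mem_rcons inE ys orbT.
move=> y z ys zT yz; have := cl y z; rewrite !mem_rcons !inE ys orbT => /(_ isT zT yz).
by case/orP => // /eqP e; have := mx y ys; rewrite -e yz.
Qed.

Lemma closed_eq s s' : s =i s' -> south_west_closed s -> south_west_closed s'.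
Proof.
move=> e [sub cl]; split=> [x|x y]; rewrite -!e; [exact: sub|exact: cl].
Qed.

(* The witness for exchanging [x] and [y] is the last box, in the row below [x],
   to the left of [y] that has been read. *)
Lemma exchange_witness u x y :
  south_west_closed u -> x \in domf T -> y \in domf T ->
  (forall z, z \in domf T -> north_east x z -> z != x -> z \in u) ->
  (forall z, z \in u -> ~~ north_east z x && ~~ north_east z y) ->
  rowb x < rowb y -> colb x < colb y ->
  exists m, [/\ m \in u, (x < m)%O, (m < y)%O &
    forall z, z \in u -> z != m -> ~~ north_east z m].
Proof.
move=> [sub cl] xT yT below ux hr hc.
have [cT _] := proj1 (increasingP T) iT.
pose P k := (Box (rowb x).+1 k \in u) && (colb x <= k).
have P0 : P (colb x).
  rewrite /P leqnn andbT; apply: below.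
  - by apply: cT xT yT _ _; rewrite box_leE !rcE; lia.
  - by rewrite /north_east !rcE; lia.
  - by rewrite box_eqE !rcE; lia.
have Pbound k : P k -> k <= colb y.
  move=> /andP[/ux /andP[_]]; rewrite /north_east !rcE; lia.
have [k /andP[ku xk] kmax] := ex_maxnP (ex_intro P _ P0) Pbound.
have ky : k < colb y.
  have := ux _ ku; rewrite /north_east !rcE; lia.
exists (Box (rowb x).+1 k); split=> //; try by rewrite box_lt_sum !rcE; lia.
move=> z zu zm; apply/negP; rewrite /north_east !rcE => zk.
have := ux z zu; rewrite /north_east => /andP[zx _].
have zr : rowb z = (rowb x).+1 by lia.
have : P (colb z) by rewrite /P -zr BoxK zu; lia.
by move/kmax => zk'; case/negP: zm; rewrite box_eqE !rcE; lia.
Qed.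

(** As neither box has to precede the other, one of them, say [x], lies strictly north-west of the
    other. Some [m] in [u] satisfies [x < m < y] and, by the hypothesis on [u], may be read last
    there. The entries [a < b < c] of [x], [m], [y] then give [b a c = b c a]. *)
Lemma read_exchange u x y :
  (forall s, linear s -> s =i u -> read s =K read u) ->
  linear (rcons (rcons u x) y) -> linear (rcons (rcons u y) x) ->
  south_west_closed (rcons (rcons u x) y) ->
  read (rcons (rcons u x) y) =K read (rcons (rcons u y) x).
Proof.
wlog xy : x y / rowb x < rowb y => [hw|] IH l1 l2 cl.
  have [/hw|yx] := ltnP (rowb x) (rowb y); first exact.
  apply/kk_sym/hw => //.
    move: l1 l2; rewrite !linear_rcons !all_rcons /north_east; lia.
  by apply: closed_eq cl => z; rewrite !mem_rcons !inE !mem_rcons !inE orbCA.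
have [xT yT] : x \in domf T /\ y \in domf T.
  by split; apply: (proj1 cl); rewrite !mem_rcons !inE !mem_rcons !inE eqxx ?orbT.
have l1' : linear (rcons u x) by move: l1; rewrite linear_rcons => /andP[].
have clu := closed_rem (closed_rem cl l1) l1'.
have [cT sT] := proj1 (increasingP T) iT.
move: (l1) (l2); rewrite !linear_rcons !all_rcons.
move=> /and3P[/andP[nxy /allP uy] /allP ux lu] /andP[/andP[nyx _] _].
have hc : colb x < colb y by move: nxy; rewrite /north_east; lia.
have [m [mu xm my mmax]] : exists m, [/\ m \in u, (x < m)%O, (m < y)%O &
    forall z, z \in u -> z != m -> ~~ north_east z m].
  apply: exchange_witness => // [z zT xz zx|z zu]; last by rewrite ux ?uy.
  have := proj2 cl x z; rewrite !mem_rcons !inE !mem_rcons !inE eqxx orbT.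
  move=> /(_ isT zT xz); rewrite (negbTE zx) /= => /orP[/eqP e|//].
  by move: xz; rewrite e (negbTE nxy).
have [a xa] := mem_fnd xT; have [c yc] := mem_fnd yT.
have [b mb] := mem_fnd (proj1 clu m mu).
have ab := strict_lt cT sT xm xa mb; have bc := strict_lt cT sT my mb yc.
pose u' := filter (predC1 m) u.
have lu' : linear (rcons u' m).
  rewrite linear_rcons linear_filter // andbT; apply/allP => z.
  by rewrite mem_filter => /andP[/= zm zu]; apply: mmax.
have eu' : rcons u' m =i u.
  move=> z; rewrite mem_rcons inE mem_filter /=.
  by case: eqVneq => [->|] //=.
have e := IH _ lu' eu'.
rewrite (read_rcons _ yc) (read_rcons _ xa) (read_rcons _ xa) (read_rcons _ yc).
rewrite (read_rcons _ mb) in e; rewrite -!cats1 -!catA /= in e *.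
apply: kk_trans (kk_sym (kk_catr [:: a; c] e)) (kk_trans _ (kk_catr [:: c; a] e)).
by rewrite -!catA; apply: kk_catl; apply: kk_right; rewrite ab.
Qed.

(** Induction on the length. If the last boxes [x] and [y] differ, either may be read last; so the
    two words are compared with readings that end in [y x] and in [x y] after the same prefix, and
    these differ by one exchange. *)
Lemma read_linear s s' : linear s -> linear s' -> s =i s' ->
  south_west_closed s -> read s =K read s'.
Proof.
have [n] := ubnP (size s); elim: n s s' => // n IH s s' sn ls ls' e cl.
case: (lastP s) sn ls e cl => [|s1 x] sn ls e cl.
  case: s' {ls'} e => [_|x s' /(_ x)]; first exact: kk_refl.
  by rewrite in_nil mem_head.
case: (lastP s') ls' e => [|s2 y] ls' e.
  by have := e x; rewrite mem_rcons inE eqxx.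
rewrite size_rcons ltnS in sn.
have us := linear_uniq ls; have us' := linear_uniq ls'.
have us1 : x \notin s1 by move: us; rewrite rcons_uniq => /andP[].
have us2 : y \notin s2 by move: us'; rewrite rcons_uniq => /andP[].
have cl1 := closed_rem cl ls; have cl2 := closed_rem (closed_eq e cl) ls'.
have ls1 : linear s1 by move: ls; rewrite linear_rcons => /andP[].
have ls2 : linear s2 by move: ls'; rewrite linear_rcons => /andP[].
have [ex|xy] := eqVneq x y.
  have e' : s1 =i s2.
    move=> z; have := e z; rewrite !mem_rcons !inE -ex.
    by case: (eqVneq z x) => [->|//] _; rewrite (negbTE us1) ex (negbTE us2).
  have [u xu] : exists u, T.[? x] = Some u.
    by apply/mem_fnd/(proj1 cl); rewrite mem_rcons inE eqxx.
  rewrite -ex !(read_rcons _ xu) -!cats1; apply: kk_catr; exact: IH e' cl1.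
have ys1 : y \in s1.
  by have := e y; rewrite !mem_rcons !inE eqxx eq_sym (negbTE xy).
have xs2 : x \in s2.
  by have := e x; rewrite !mem_rcons !inE eqxx (negbTE xy).
pose u := filter (predC1 y) s1.
have lu : linear u by apply: linear_filter.
have eu z : (z \in u) = [&& z \in rcons s1 x, z != x & z != y].
  rewrite mem_filter /= mem_rcons inE; case: (eqVneq z x) => [->|] //=.
    by rewrite (negbTE us1) andbF.
  by rewrite andbC.
have luy : linear (rcons u y).
  rewrite linear_rcons lu andbT; apply/allP => z; rewrite eu => /and3P[zs _ zy].
  move: ls'; rewrite linear_rcons => /andP[/allP h _]; apply: h.
  by move: zs; rewrite e mem_rcons inE (negbTE zy).
have lux : linear (rcons u x).
  rewrite linear_rcons lu andbT; apply/allP => z; rewrite eu => /and3P[zs zx _].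
  move: ls; rewrite linear_rcons => /andP[/allP h _]; apply: h.
  by move: zs; rewrite mem_rcons inE (negbTE zx).
have e1 : s1 =i rcons u y.
  move=> z; rewrite mem_rcons inE eu mem_rcons inE.
  case: (eqVneq z y) => [->|zy] //=; rewrite andbT.
  by case: (eqVneq z x) => [->|_]; rewrite ?(negbTE us1) ?andbT.
have e2 : s2 =i rcons u x.
  move=> z; rewrite mem_rcons inE eu e mem_rcons inE.
  case: (eqVneq z x) => [->|zx] //=.
  by case: (eqVneq z y) => [->|//]; rewrite ?(negbTE us2) // andbT.
have size2 : size s2 < n.
  by have := perm_size (uniq_perm us us' e); rewrite !size_rcons => -[<-].
have lasts (t1 t2 : seq box) z : {subset rcons t1 z <= domf T} ->
    read t1 =K read t2 -> read (rcons t1 z) =K read (rcons t2 z).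
  move=> sub h; have [|v zv] := @mem_fnd _ T z.
    by apply: sub; rewrite mem_rcons inE eqxx.
  by rewrite !(read_rcons _ zv) -!cats1; apply: kk_catr.
have clux : linear (rcons (rcons u x) y).
  move: ls'; rewrite !linear_rcons => /andP[/allP h _]; apply/andP; split.
    by apply/allP => z; rewrite -e2; apply: h.
  by move: lux; rewrite linear_rcons.
have cluy : linear (rcons (rcons u y) x).
  move: ls; rewrite !linear_rcons => /andP[/allP h _]; apply/andP; split.
    by apply/allP => z; rewrite -e1; apply: h.
  by move: luy; rewrite linear_rcons.
have ext : rcons (rcons u y) x =i rcons s1 x.
  by move=> z; rewrite !mem_rcons !inE e1.
have clxy : south_west_closed (rcons (rcons u x) y).
  by apply: closed_eq cl => z; rewrite -ext !mem_rcons !inE !mem_rcons !inE orbCA.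
apply: kk_trans (lasts _ _ _ (proj1 cl) (IH _ _ sn ls1 luy e1 cl1)) _.
apply: kk_trans _ (kk_sym
  (lasts _ _ _ (proj1 (closed_eq e cl)) (IH _ _ size2 ls2 lux e2 cl2))).
apply/kk_sym/read_exchange => // t lt et.
apply: (IH _ _ _ lt lu et).
  rewrite (perm_size (uniq_perm (linear_uniq lt) (linear_uniq lu) et)).
  by apply: leq_ltn_trans sn; rewrite size_filter count_size.
by apply: closed_eq (closed_rem (closed_rem clxy clux) lux) => z; rewrite et.
Qed.

End ReadingWords.

Lemma reading_word_kk T w w' : increasing T ->
  reading_word T w -> reading_word T w' -> w =K w'.
Proof.
move=> iT [s os ->] [s' os' ->].
have [_ e _] := os; have [_ e' _] := os'.
apply: (read_linear iT (reading_order_linear os) (reading_order_linear os')).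
  by move=> x; rewrite e e'.
by split=> [x|x y _]; rewrite e.
Qed.

(** * Slides preserve the K-Knuth class *)

Definition row_before (x y : box) : bool :=
  (rowb y < rowb x) || (rowb x == rowb y) && (colb x < colb y).

Lemma row_before_irr : irreflexive row_before.
Proof. by move=> x; rewrite /row_before; lia. Qed.

Lemma row_before_reading (A : {fset box}) s :
  pairwise row_before s -> s =i A -> reading_order A s.
Proof.
move=> ps sA; have us : uniq s.
  rewrite uniq_pairwise; apply: sub_pairwise ps => x y.
  by apply: contraTneq => ->; rewrite row_before_irr.
split=> // x y; rewrite -!sA => xs ys yx h1 h2.
rewrite ltnNge leq_eqVlt; apply/negP => /orP[/eqP e|lt].
  case/eqP: yx; rewrite -(nth_index (Box 0 0) ys) -(nth_index (Box 0 0) xs).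
  by rewrite e.
have /(pairwiseP (Box 0 0)) h := ps.
have := h (index y s) (index x s); rewrite !inE !index_mem !nth_index //.
move=> /(_ ys xs lt); rewrite /row_before.
by rewrite -/(rowb _) -/(colb _) in h1 h2; rewrite /rowb /colb in h1 h2 *; lia.
Qed.

Lemma pairwise_row_before rs cs :
  pairwise gtn rs -> pairwise ltn cs ->
  pairwise row_before [seq Box r c | r <- rs, c <- cs].
Proof.
elim: rs => //= r rs IH /andP[/allP hr prs] pcs.
rewrite pairwise_cat IH // andbT pairwise_map; apply/andP; split.
  apply/allrelP => x y /mapP[c _ ->] /allpairsP[[r' c'] /= [hr' _ ->]].
  by rewrite /row_before !rcE; have /= -> := hr _ hr'.
by apply: sub_pairwise pcs => c c' /= cc; rewrite /row_before !rcE eqxx cc orbT.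
Qed.

Definition rows n : seq box := [seq Box r c | r <- rev (iota 0 n), c <- iota 0 n].

Lemma pairwise_rows n : pairwise row_before (rows n).
Proof.
apply: pairwise_row_before; last first.
  by rewrite -(sorted_pairwise ltn_trans); apply: iota_ltn_sorted.
rewrite -(sorted_pairwise (rev_trans ltn_trans)) rev_sorted; exact: iota_ltn_sorted.
Qed.

Lemma mem_rows n x : rowb x < n -> colb x < n -> x \in rows n.
Proof.
move=> xr xc; apply/allpairsP; exists (rowb x, colb x).
by rewrite /= BoxK mem_rev !mem_iota.
Qed.

Definition cut (t : box -> option int) r c := t (Box r c).

Lemma cutE t r c o : t (Box r c) = o -> cut t r c = o. Proof. by []. Qed.

Definition row_word (t : box -> option int) n r : seq int :=
  pmap (cut t r) (iota 0 n).

Definition rows_word (t : box -> option int) n rs : seq int :=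
  flatten [seq row_word t n r | r <- rs].

Definition word n (t : box -> option int) : seq int :=
  rows_word t n (rev (iota 0 n)).

Lemma rows_wordE t n rs :
  rows_word t n rs = pmap t [seq Box r c | r <- rs, c <- iota 0 n].
Proof.
elim: rs => //= r rs IH; rewrite /rows_word /= -/(rows_word _ _ _) IH pmap_cat.
by congr (_ ++ _); rewrite /row_word; elim: (iota 0 n) => //= c cs ->.
Qed.

Lemma pmap_filter_dom (T : tableau) s :
  pmap (fun x => T.[? x]) [seq x <- s | x \in domf T] = pmap (fnd T) s.
Proof.
elim: s => //= x s <-; case: ifP => [_|/negbT xT] //=.
by rewrite not_fnd.
Qed.

Lemma word_reading (T : tableau) n :
  (forall x, x \in domf T -> rowb x < n /\ colb x < n) ->
  reading_word T (word n (fnd T)).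
Proof.
move=> bd.
exists [seq x <- rows n | x \in domf T].
  apply: row_before_reading => [|x].
    exact: subseq_pairwise (filter_subseq _ _) (pairwise_rows n).
  by rewrite mem_filter; case xT: (x \in domf T) => //=;
    have [xr xc] := bd x xT; apply: mem_rows.
by rewrite pmap_filter_dom /word rows_wordE.
Qed.

(** * Replacing the entries along the row word *)

Section SlideWord.
Variables (S : {fset box}) (T0 T1 : tableau) (n : nat).
Hypothesis sr : slide_rel S (fnd T0) (fnd T1).
Hypothesis bound : forall x, x \in S -> rowb x < n /\ colb x < n.

Let t0 := fnd T0.
Let t1 := fnd T1.

Lemma sorted_row (T : tableau) r cs : increasing T -> sorted ltn cs ->
  sorted <%R (pmap (cut (fnd T) r) cs).
Proof.
move=> /increasingP[cT sT]; rewrite (sorted_pairwise ltn_trans).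
rewrite (sorted_pairwise lt_trans); elim: cs => //= c cs IH /andP[/allP hc pcs].
case tc: (cut _ r c) => [u|] /=; last exact: IH.
rewrite IH // andbT; apply/allP => v; rewrite mem_pmap => /mapP[d dcs td].
apply: (strict_lt cT sT _ tc (esym td)); rewrite box_lt_sum !rcE.
by have := hc _ dcs => /=; lia.
Qed.

Lemma iota_split c : c < n -> iota 0 n = iota 0 c ++ c :: iota c.+1 (n - c.+1).
Proof.
move=> cn; rewrite -{1}(subnKC (ltnW cn)) iotaD add0n.
by have -> : n - c = (n - c.+1).+1 by lia.
Qed.

Lemma pmap_iotaS (f : nat -> option int) c :
  pmap f (iota 0 c.+1) = pmap f (iota 0 c) ++ pmap f [:: c].
Proof. by rewrite -addn1 iotaD pmap_cat. Qed.

Lemma pmap_iotaS_Some (f : nat -> option int) c u : f c = Some u ->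
  pmap f (iota 0 c.+1) = rcons (pmap f (iota 0 c)) u.
Proof. by move=> fc; rewrite pmap_iotaS /= fc cats1. Qed.

(** Row [r] between the deletion of the old entry in column [c] and the insertion of the new one. *)
Definition half_row r c :=
  pmap (cut t1 r) (iota 0 c) ++ pmap (cut t0 r) (iota c.+1 (n - c.+1)).

(** [lo] starts with the row above, which is already replaced. A copy of the old entry to the left
    is an adjacent equal letter; for a copy above, [kk_delete] is applied to the two rows. *)
Lemma delete_box r c lo : r < n -> c < n ->
  (forall r', r = r'.+1 -> exists lo', lo = row_word t1 n r' ++ lo') ->
  t0 (Box r c) <> t1 (Box r c) ->
  (pmap (cut t1 r) (iota 0 c) ++ pmap (cut t0 r) (c :: iota c.+1 (n - c.+1))) ++ lo
  =K half_row r c ++ lo.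
Proof.
move=> rn cn hlo neq; rewrite /half_row /=.
case x0: (t0 (Box r c)) neq => [v|] neq; rewrite (cutE x0) /=; last exact: kk_refl.
have [cS sub0 sub1 s0 s1 d0 d1 le le_adj del ins] := sr.
have xS := sub0 _ _ x0.
have [left|nleft] := eqVneq (if c is c'.+1 then t1 (Box r c') else None) (Some v).
  case: c left {cn neq x0 xS} => // c left.
  rewrite pmap_iotaS /= (cutE left) /= -!catA /=.
  exact/kk_catl/kk_idem.
have [e|[y yx ty]] := del _ _ x0; first by case: neq; apply: esym.
have [yE [r' rE]] : y = Box r.-1 c /\ exists r', r = r'.+1.
  move: yx; rewrite /adj !rcE => /orP[/andP[/eqP er /eqP ec]|/andP[/eqP er /eqP ec]].
    by case/eqP: nleft; rewrite ec -er BoxK.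
  by split; [apply: box_eqP; rewrite !rcE ?er|exists (rowb y)].
rewrite {}yE rE /= in ty.
have [lo' ->] := hlo _ rE; rewrite {hlo}rE in rn x0 neq xS nleft *.
have yS := sub1 _ _ ty.
have i1 := slide_rel_increasing1 sr; have [c1 _] := proj1 (increasingP T1) i1.
rewrite /row_word (iota_split cn) pmap_cat /= (cutE ty) /=.
have := @kk_delete (iota c.+1 (n - c.+1)) (cut t1 r') (cut t0 r'.+1) v
   (pmap (cut t1 r') (iota 0 c)) (pmap (cut t1 r'.+1) (iota 0 c)).
rewrite !cat_rcons => h; rewrite !catA; apply: kk_catr; rewrite -!catA; apply/kk_sym.
move: h; rewrite -!catA; apply.
- have := sorted_row r' i1 (iota_ltn_sorted 0 n).
  by rewrite (iota_split cn) pmap_cat /= (cutE ty).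
- move=> j u; rewrite mem_iota => hj tj; have jS := sub0 _ _ tj.
  have zS : Box r' j \in S.
    by apply: (cS (Box r' c) _ (Box r'.+1 j)); rewrite // box_leE !rcE; lia.
  have := d1 _ _ (adjD r' j) zS jS; rewrite -/t1 /cut.
  case z1: (t1 (Box r' j)) => [w|//] _; exists w => //.
  exact: le_adj (adjD _ _) z1 tj.
(* The new entry [b] left of the deleted one is the required letter: it exceeds the entry above it,
   is at most [v] by [sr_le_adj], and differs from [v] because that case has been settled. *)
- move=> A' a1 EA.
  have [j jc [w tj]] : exists2 j, j < c & exists w, t1 (Box r' j) = Some w.
    have : a1 \in pmap (cut t1 r') (iota 0 c) by rewrite EA mem_rcons mem_head.
    by rewrite mem_pmap => /mapP[j]; rewrite mem_iota => hj e; exists j; [lia|exists a1].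
  have [d dE] : exists d, c = d.+1 by exists c.-1; lia.
  subst c.
  have cT : Box r' d \in domf T1.
    apply: (c1 (Box r' j) _ (Box r' d.+1)) (fnd_mem tj) (fnd_mem ty) _ _;
    by rewrite box_leE !rcE; lia.
  have [a ta] := mem_fnd cT.
  have zS : Box r'.+1 d \in S.
    by apply: (cS (Box r' d) _ (Box r'.+1 d.+1)); rewrite ?(sub1 _ _ ta) // box_leE !rcE; lia.
  have := d1 _ _ (adjR r'.+1 d) zS xS; rewrite -/t1.
  case tb: (t1 (Box r'.+1 d)) => [b|//] _.
  move: EA; rewrite (pmap_iotaS_Some (cutE ta)) => /rcons_inj[_ <-].
  exists (pmap (cut t1 r'.+1) (iota 0 d)), b.
  rewrite (pmap_iotaS_Some (cutE tb)).
  split=> //; rewrite (s1 _ _ _ _ (adjD r' d) ta tb) /= lt_neqAle.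
  rewrite (le_adj _ _ _ _ (adjR r'.+1 d) tb x0) andbT.
  by apply: contra nleft => /eqP <-; rewrite tb.
Qed.

(** Dual to [delete_box]: [hi] ends with the row below, which still has its old entries. If the copy
    of the new entry is in that row, [bound] yields [r.+1 < n]. *)
Lemma insert_box r c hi : r < n -> c < n ->
  (r.+1 < n -> exists hi', hi = hi' ++ row_word t0 n r.+1) ->
  t0 (Box r c) <> t1 (Box r c) ->
  hi ++ half_row r c =K
  hi ++ (pmap (cut t1 r) (iota 0 c.+1) ++ pmap (cut t0 r) (iota c.+1 (n - c.+1))).
Proof.
move=> rn cn hhi neq; rewrite /half_row pmap_iotaS /=.
case x1: (t1 (Box r c)) neq => [m|] neq; rewrite (cutE x1) /=;
  last by rewrite cats0; exact: kk_refl.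
have [cS sub0 sub1 s0 s1 d0 d1 le le_adj del ins] := sr.
have xS := sub1 _ _ x1.
have [right|nright] := eqVneq (t0 (Box r c.+1)) (Some m).
  have [_ ] := bound (sub0 _ _ right); rewrite colbE => cn'.
  have -> : n - c.+1 = (n - c.+2).+1 by lia.
  rewrite /= (cutE right) /= -!catA; do 2!apply: kk_catl.
  exact/kk_sym/kk_idem.
have [e|[y xy ty]] := ins _ _ x1; first by case: neq.
have yE : y = Box r.+1 c.
  move: xy; rewrite /adj !rcE => /orP[/andP[/eqP er /eqP ec]|/andP[/eqP er /eqP ec]].
    by case/eqP: nright; rewrite er -ec BoxK.
  by apply: box_eqP; rewrite !rcE.
rewrite {}yE in ty; have yS := sub0 _ _ ty.
have [] := bound yS; rewrite !rcE => rn' _.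
have [hi' ->] := hhi rn'.
have i0 := slide_rel_increasing0 sr; have [c0 _] := proj1 (increasingP T0) i0.
rewrite /row_word (iota_split cn) pmap_cat /= (cutE ty) /= -!catA /=.
apply: kk_catl.
have := @kk_insert (iota 0 c) (cut t0 r.+1) (cut t1 r) m
   (pmap (cut t0 r.+1) (iota c.+1 (n - c.+1))) (pmap (cut t0 r) (iota c.+1 (n - c.+1))).
rewrite -!catA; apply.
- have := sorted_row r.+1 i0 (iota_ltn_sorted 0 n).
  by rewrite (iota_split cn) pmap_cat /= (cutE ty).
- move=> j u; rewrite mem_iota => hj tj; have jS := sub1 _ _ tj.
  have zS : Box r.+1 j \in S.
    by apply: (cS (Box r j) _ (Box r.+1 c)); rewrite // box_leE !rcE; lia.
  have := d0 _ _ (adjD r j) jS zS; rewrite -/t0 /cut.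
  case z0: (t0 (Box r.+1 j)) => [w|//] _; exists w => //.
  exact: le_adj (adjD _ _) tj z0.
- move=> a1 A' EA.
  have [j /andP[jc jn] [w tj]] :
      exists2 j, c < j < n & exists w, t0 (Box r.+1 j) = Some w.
    have : a1 \in pmap (cut t0 r.+1) (iota c.+1 (n - c.+1)) by rewrite EA mem_head.
    by rewrite mem_pmap => /mapP[j]; rewrite mem_iota => hj e; exists j; [lia|exists a1].
  have cT : Box r.+1 c.+1 \in domf T0.
    apply: (c0 (Box r.+1 c) _ (Box r.+1 j)) (fnd_mem ty) (fnd_mem tj) _ _;
    by rewrite box_leE !rcE; lia.
  have [a ta] := mem_fnd cT.
  have zS : Box r c.+1 \in S.
    by apply: (cS (Box r c) _ (Box r.+1 c.+1)); rewrite ?(sub0 _ _ ta) // box_leE !rcE; lia.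
  have := d0 _ _ (adjR r c) xS zS; rewrite -/t0.
  case tb: (t0 (Box r c.+1)) => [b|//] _.
  have e : n - c.+1 = (n - c.+2).+1 by lia.
  move: EA; rewrite e /= (cutE ta) /= => -[<- _].
  exists b, (pmap (cut t0 r) (iota c.+2 (n - c.+2))).
  rewrite (cutE tb) /=; split=> //.
  rewrite (s0 _ _ _ _ (adjD r c.+1) tb ta) andbT lt_neqAle.
  rewrite (le_adj _ _ _ _ (adjR r c) x1 tb) andbT.
  by apply: contra nright => /eqP ->; rewrite tb.
Qed.

(** Rows are replaced downwards and each row from left to right. Then the boxes to the left and
    above hold new entries, as deletion requires, while those to the right and below hold old ones,
    as insertion requires. *)
Definition partly r c (x : box) : option int :=
  if (rowb x < r) || (rowb x == r) && (colb x < c) then t1 x else t0 x.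

Lemma rows_word_ext t t' rs :
  (forall r c, r \in rs -> t (Box r c) = t' (Box r c)) ->
  rows_word t n rs = rows_word t' n rs.
Proof.
move=> e; congr flatten; apply/eq_in_map => r hr; rewrite /row_word.
by apply: eq_pmap => c; apply: e.
Qed.

Lemma word_split t r : r < n ->
  word n t = rows_word t n (rev (iota r.+1 (n - r.+1))) ++
             (row_word t n r ++ rows_word t n (rev (iota 0 r))).
Proof.
move=> rn; rewrite /word /rows_word (iota_split rn) rev_cat rev_cons map_cat.
by rewrite flatten_cat map_rcons flatten_rcons -!catA.
Qed.

Lemma word_partlyS r c : r < n -> c < n ->
  word n (partly r c) =K word n (partly r c.+1).
Proof.
move=> rn cn.
pose hi := rows_word t0 n (rev (iota r.+1 (n - r.+1))).
pose lo := rows_word t1 n (rev (iota 0 r)).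
have hiE d : rows_word (partly r d) n (rev (iota r.+1 (n - r.+1))) = hi.
  apply: rows_word_ext => r' c'; rewrite mem_rev mem_iota /partly !rcE => hr.
  by rewrite ifF //; lia.
have loE d : rows_word (partly r d) n (rev (iota 0 r)) = lo.
  apply: rows_word_ext => r' c'; rewrite mem_rev mem_iota /partly !rcE => hr.
  by rewrite ifT //; lia.
have rowE d e : e = iota d (n - d) -> d <= n -> row_word (partly r d) n r =
    pmap (cut t1 r) (iota 0 d) ++ pmap (cut t0 r) e.
  move=> -> dn; rewrite /row_word -{1}(subnKC dn) iotaD pmap_cat add0n.
  congr (_ ++ _); apply/eq_in_pmap => j; rewrite mem_iota /cut /partly !rcE => hj.
    by rewrite ifT //; lia.
  by rewrite ifF //; lia.
rewrite !(word_split _ rn) !hiE !loE.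
rewrite (rowE c (c :: iota c.+1 (n - c.+1))) ?(ltnW cn) //; last first.
  by rewrite -[n - c]prednK ?subn_gt0 //= subnS.
rewrite (rowE c.+1 (iota c.+1 (n - c.+1))) //.
have [e|/eqP neq] := eqVneq (t0 (Box r c)) (t1 (Box r c)).
  rewrite pmap_iotaS /= -!catA /cut e.
  by case: (t1 _) => [u|] /=; exact: kk_refl.
apply: kk_trans (kk_catl hi (delete_box rn cn _ neq)) _.
  move=> r' rE; exists (rows_word t1 n (rev (iota 0 r'))).
  by rewrite /lo rE /rows_word -addn1 iotaD rev_cat.
rewrite !catA; apply: kk_catr; rewrite -!catA; apply: (insert_box rn cn _ neq) => rn'.
exists (rows_word t0 n (rev (iota r.+2 (n - r.+2)))).
rewrite /hi; have -> : n - r.+1 = (n - r.+2).+1 by lia.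
by rewrite /rows_word /= rev_cons map_rcons flatten_rcons.
Qed.

Lemma word_slide : word n t0 =K word n t1.
Proof.
have ext t t' : (forall x, rowb x < n -> colb x < n -> t x = t' x) ->
    word n t = word n t'.
  move=> h; rewrite /word !rows_wordE; apply/eq_in_pmap => x.
  by case/allpairsP => -[r c] [/=]; rewrite mem_rev !mem_iota => hr hc ->; apply: h;
    rewrite ?rowbE ?colbE; lia.
have rowc r c : r < n -> c <= n -> word n (partly r 0) =K word n (partly r c).
  move=> rn; elim: c => [_|c IH cn]; first exact: kk_refl.
  exact: kk_trans (IH (ltnW cn)) (word_partlyS rn cn).
have down_to r : r <= n -> word n (partly 0 0) =K word n (partly r 0).
  elim: r => [_|r IH rn]; first exact: kk_refl.
  apply: kk_trans (IH (ltnW rn)) _; apply: kk_trans (rowc r n rn _) _ => //.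
  rewrite (ext (partly r n) (partly r.+1 0)); first exact: kk_refl.
  move=> x xr xc; rewrite /partly; congr (if _ then _ else _).
  by rewrite xc ltnS leq_eqVlt; lia.
rewrite (ext t0 (partly 0 0)) => [|x _ _]; last by rewrite /partly ifF //; lia.
rewrite (ext t1 (partly n 0)) => [|x xr _]; last by rewrite /partly xr.
exact: down_to.
Qed.

End SlideWord.

Lemma slide_step_kk T T' : slide_step T T' -> kknuth_equivalent T T'.
Proof.
have h S (T0 T1 : tableau) : slide_rel S (fnd T0) (fnd T1) ->
    exists w w', [/\ reading_word T0 w, reading_word T1 w' & w =K w'].
  move=> sr; have [n bd] := boxes_bounded S.
  exists (word n (fnd T0)), (word n (fnd T1)); split.
  - by apply: word_reading => x /(fsubsetP (slide_rel_sub0 sr)); apply: bd.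
  - by apply: word_reading => x /(fsubsetP (slide_rel_sub1 sr)); apply: bd.
  - exact: word_slide sr bd.
case/slide_step_rel => S [/h //|/h [w [w' [r r' e]]]].
by exists w', w; split=> //; apply: kk_sym.
Qed.

(** * Shifting rows *)

(** [jdt_equivalent] is only a reflexive transitive closure; carrying both directions provides
    symmetry. *)
Definition sim (T T' : tableau) : Prop :=
  jdt_equivalent T T' /\ jdt_equivalent T' T.

Lemma sim_refl T : sim T T. Proof. by split; apply: rt_refl. Qed.

Lemma sim_sym T T' : sim T T' -> sim T' T. Proof. by case. Qed.

Lemma sim_trans T2 T1 T3 : sim T1 T2 -> sim T2 T3 -> sim T1 T3.
Proof. by move=> [h1 h2] [h3 h4]; split; apply: rt_trans; eassumption. Qed.

Lemma sim_slide S (T T' : tableau) : slide_rel S (fnd T) (fnd T') -> sim T T'.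
Proof. by move=> /slide_rel_step[h h']; split; apply: rt_step. Qed.

(** The subtraction is not truncated on the listed boxes, since each arises by adding the same
    shift. No dot occurs; [delete_dots] merely turns optional values into entries. *)
Definition hshift (f : nat -> nat) (T : tableau) : tableau :=
  delete_dots (filling [fset Box (rowb y) (colb y + f (rowb y)) | y : box in domf T]
    (fun x => T.[? Box (rowb x) (colb x - f (rowb x))])).

Lemma fnd_hshift f T x u :
  (hshift f T).[? x] = Some u <->
  exists a, colb x = a + f (rowb x) /\ T.[? Box (rowb x) a] = Some u.
Proof.
rewrite fnd_delete_dots; case: ifP => [/imfsetP[/= y yT ->]|xT].
  rewrite !rcE addnK BoxK; split=> [h|[a [/addIn <-]]]; last by rewrite BoxK.
  by exists (colb y); rewrite BoxK.
split=> // -[a [xa ta]]; case/imfsetP: xT; exists (Box (rowb x) a) => /=.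
  exact: fnd_mem ta.
by apply: box_eqP; rewrite !rcE.
Qed.

Lemma mem_hshift f T x :
  x \in domf (hshift f T) <->
  exists a, colb x = a + f (rowb x) /\ Box (rowb x) a \in domf T.
Proof.
split=> [/mem_fnd[u /fnd_hshift[a [xa ta]]]|[a [xa /mem_fnd[u ta]]]].
  by exists a; rewrite (fnd_mem ta).
by apply: (@fnd_mem _ _ _ u); apply/fnd_hshift; exists a.
Qed.

Definition noninc (f : nat -> nat) : Prop := forall i j, i <= j -> f j <= f i.

Lemma le_entries T x y u v : increasing T -> (x <= y)%O ->
  T.[? x] = Some u -> T.[? y] = Some v -> (u <= v)%R.
Proof.
move=> /increasingP[cT sT]; rewrite le_eqVlt => /orP[/eqP <- -> [->]//|xy tx ty].
exact/ltW/(strict_lt cT sT xy tx ty).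
Qed.

(** Of two boxes in one column of the shifted tableau, the upper one has been shifted at least as
    far, so it comes from a column weakly further left. Both convexity and strictness follow from
    those of [T]. *)
Lemma hshift_increasing f T : noninc f -> increasing T -> increasing (hshift f T).
Proof.
move=> nf /increasingP[cT sT]; apply/increasingP; split.
  move=> x y z /mem_hshift[a [xa aT]] /mem_hshift[c [zc zT]].
  rewrite !box_leE => xy yz; apply/mem_hshift.
  have h1 : f (rowb y) <= f (rowb x) by apply: nf; lia.
  have h2 : f (rowb z) <= f (rowb y) by apply: nf; lia.
  exists (colb y - f (rowb y)); split; first by lia.
  by apply: cT aT zT _ _; rewrite box_leE !rcE; lia.
move=> x y u v xy /fnd_hshift[a [xa ta]] /fnd_hshift[b [yb tb]].
have h1 : f (rowb y) <= f (rowb x) by apply: nf; move: xy; rewrite /adj; lia.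
apply: (strict_lt cT sT _ ta tb); move: xy; rewrite /adj box_lt_sum !rcE.
by case/orP => /andP[/eqP e1 /eqP e2]; rewrite ?e1 in xa yb h1 *; lia.
Qed.

(* The slide through row [k] that moves this row one step to the left. *)
Lemma hshift_slide T f f' k : increasing T -> noninc f -> noninc f' ->
  (forall r, f r = f' r + (r == k)) ->
  exists S, slide_rel S (fnd (hshift f T)) (fnd (hshift f' T)).
Proof.
move=> iT nf nf' ff'; have [cT sT] := proj1 (increasingP T) iT.
have i0 := hshift_increasing nf iT; have [c0 s0] := proj1 (increasingP _) i0.
have i1 := hshift_increasing nf' iT; have [c1 s1] := proj1 (increasingP _) i1.
have hf r : (r = k /\ f r = (f' r).+1) \/ (r <> k /\ f r = f' r).
  by have := ff' r; case: eqP => ? ->; [left|right]; split; rewrite ?addn1 ?addn0.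
have convT r1 a1 r2 a2 r3 a3 : Box r1 a1 \in domf T -> Box r3 a3 \in domf T ->
    r1 <= r2 <= r3 -> a1 <= a2 <= a3 -> Box r2 a2 \in domf T.
  by move=> h1 h3 hr ha; apply: cT h1 h3 _ _; rewrite box_leE !rcE; lia.
set T0 := hshift f T; set T1 := hshift f' T.
exists (domf T0 `|` domf T1).
have memS x : x \in domf T0 `|` domf T1 -> exists a d,
    [/\ colb x = a + d, Box (rowb x) a \in domf T & d = f (rowb x) \/ d = f' (rowb x)].
  rewrite in_fsetU => /orP[] /mem_hshift[a [xa aT]].
    by exists a, (f (rowb x)); split=> //; left.
  by exists a, (f' (rowb x)); split=> //; right.
have monoA x y : adj x y -> [/\ rowb x <= rowb y, f (rowb y) <= f (rowb x),
    f' (rowb y) <= f' (rowb x) &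
    [/\ rowb x = rowb y, colb y = (colb x).+1, f (rowb x) = f (rowb y)
        & f' (rowb x) = f' (rowb y)] \/
    rowb y = (rowb x).+1 /\ colb x = colb y].
  move=> xy; split; [|apply: nf|apply: nf'|]; try by move: xy; rewrite /adj; lia.
  by move: xy; rewrite /adj => /orP[] /andP[/eqP e1 /eqP e2]; [left; rewrite e1|right].
split=> //.
- move=> x y z xS zS xy yz.
  have [-> //|yx] := eqVneq y x; have [-> //|yz'] := eqVneq y z.
  have [a [d [xa aT da]]] := memS _ xS; have [c [e [zc cS ec]]] := memS _ zS.
  move: xy yz yx yz'; rewrite !box_leE !box_eqE => xy yz yx yz'.
  have h1 : f (rowb y) <= f (rowb x) by apply: nf; lia.
  have h2 : f (rowb z) <= f (rowb y) by apply: nf; lia.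
  have h3 : f' (rowb y) <= f' (rowb x) by apply: nf'; lia.
  have h4 : f' (rowb z) <= f' (rowb y) by apply: nf'; lia.
  have hx := hf (rowb x); have hy := hf (rowb y); have hz := hf (rowb z).
  have : (a + f (rowb y) <= colb y <= c + f (rowb y)) \/
         (a + f' (rowb y) <= colb y <= c + f' (rowb y)).
    have exy : rowb x = rowb y -> f (rowb x) = f (rowb y) by move->.
    have eyz : rowb y = rowb z -> f (rowb y) = f (rowb z) by move->.
    by case: da ec => [->|->] [->|->] in xa zc *; lia.
  rewrite in_fsetU => -[] h; apply/orP; [left|right]; apply/mem_hshift.
    exists (colb y - f (rowb y)); split; first by lia.
    by apply: convT aT cS _ _; lia.
  exists (colb y - f' (rowb y)); split; first by lia.
  by apply: convT aT cS _ _; lia.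
- by move=> x u tx; rewrite in_fsetU (fnd_mem tx).
- by move=> x u tx; rewrite in_fsetU (fnd_mem tx) orbT.
- move=> x y xy xS yS; suff /mem_fnd[u ->] : y \in domf T0 by [].
  have [a [d [xa aT da]]] := memS _ xS; have [b [e [yb bT eb]]] := memS _ yS.
  have [h1 h2 h3 h4] := monoA _ _ xy.
  have hx := hf (rowb x); have hy := hf (rowb y).
  apply/mem_hshift; have [ye|ye] := eqVneq e (f (rowb y)).
    by exists b; rewrite -ye.
  have ey : f (rowb y) = (f' (rowb y)).+1 by move/eqP: ye; lia.
  have ab : a < b by case: h4 => [[e1 e2 e3 e4]|[e1 e2]]; lia.
  exists b.-1; split; first by lia.
  by apply: convT aT bT _ _; lia.
- move=> x y xy xS yS; suff /mem_fnd[u ->] : x \in domf T1 by [].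
  have [a [d [xa aT da]]] := memS _ xS; have [b [e [yb bT eb]]] := memS _ yS.
  have [h1 h2 h3 h4] := monoA _ _ xy.
  have hx := hf (rowb x); have hy := hf (rowb y).
  apply/mem_hshift; have [xd|xd] := eqVneq d (f' (rowb x)).
    by exists a; rewrite -xd.
  have ex : f (rowb x) = (f' (rowb x)).+1 by move/eqP: xd; lia.
  have ab : a < b by case: h4 => [[e1 e2 e3 e4]|[e1 e2]]; lia.
  exists a.+1; split; first by lia.
  by apply: convT aT bT _ _; lia.
- move=> x u v /fnd_hshift[a [xa ta]] /fnd_hshift[b [xb tb]].
  apply: le_entries iT _ ta tb; rewrite box_leE !rcE.
  by have := hf (rowb x); lia.
- move=> x y u v xy /fnd_hshift[a [xa ta]] /fnd_hshift[b [yb tb]].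
  apply: le_entries iT _ ta tb; rewrite box_leE !rcE.
  have [h1 h2 h3 h4] := monoA _ _ xy; have hx := hf (rowb x); have hy := hf (rowb y).
  by move: h4 => [[e1 e2 e3 e4]|[e1 e2]]; lia.
- move=> x u /fnd_hshift[a [xa ta]].
  have [[xk fx]|[_ fx]] := hf (rowb x); last first.
    by left; apply/fnd_hshift; exists a; rewrite -fx.
  right; exists (Box (rowb x) (a + f' (rowb x))).
    by rewrite /adj !rcE; lia.
  by apply/fnd_hshift; exists a; rewrite !rcE.
- move=> x u /fnd_hshift[a [xa ta]].
  have [[xk fx]|[_ fx]] := hf (rowb x); last first.
    by left; apply/fnd_hshift; exists a; rewrite fx.
  right; exists (Box (rowb x) (a + f (rowb x))).
    by rewrite /adj !rcE; lia.
  by apply/fnd_hshift; exists a; rewrite !rcE.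
Qed.

Lemma fnd_ext (T T' : tableau) :
  (forall x u, T.[? x] = Some u <-> T'.[? x] = Some u) -> T = T'.
Proof.
move=> h; apply/fmapP => x; case tx: T.[? x] => [u|]; first by apply/esym/h.
by case tx': T'.[? x] => [v|//]; rewrite (proj2 (h x v) tx') in tx.
Qed.

Lemma hshift_ext f f' T : (forall x, x \in domf T -> f (rowb x) = f' (rowb x)) ->
  hshift f T = hshift f' T.
Proof.
move=> ff'; apply: fnd_ext => x u; rewrite !fnd_hshift.
by split=> -[a [xa ta]]; exists a; split=> //;
  have := ff' _ (fnd_mem ta); rewrite rowbE; lia.
Qed.

(** One unit at a time is taken off the lowest row with a nonzero shift, which keeps the shift
    nonincreasing and is a single slide. Below the last row of [T] the shift may be set to 0, so
    there are finitely many units. *)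
Lemma hshift_sim f T : noninc f -> increasing T -> sim T (hshift f T).
Proof.
move=> nf iT.
have base n : forall g, noninc g -> (forall r, n <= r -> g r = 0) -> sim T (hshift g T).
  elim: n => [|n IH] g ng g0.
    suff <- : T = hshift g T by exact: sim_refl.
    apply: fnd_ext => x u; rewrite fnd_hshift g0 //.
    split=> [tx|[a [xa]]]; last by rewrite -[a]addn0 -xa BoxK.
    by exists (colb x); rewrite addn0 BoxK.
  move k_def: (g n) => k; elim: k g k_def ng g0 => [|k IHk] g gn ng g0.
    apply: IH => // r; rewrite leq_eqVlt => /orP[/eqP <- //|]; exact: g0.
  pose g' r := g r - (r == n).
  have ng' : noninc g'.
    move=> i j ij; rewrite /g'; have := ng i j ij.
    have [ei|ni] := eqVneq i n; last by lia.
    have [ej|nj] := eqVneq j n; first by rewrite ei ej.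
    by rewrite (g0 j) //; lia.
  have [S sr] : exists S, slide_rel S (fnd (hshift g T)) (fnd (hshift g' T)).
    by apply: (@hshift_slide T g g' n) => // r; rewrite /g'; case: eqVneq => [->|_]; lia.
  apply: sim_trans (sim_sym (sim_slide sr)); apply: IHk => //.
    by rewrite /g' gn eqxx; lia.
  by move=> r nr; rewrite /g' g0.
pose n := (\max_(x <- domf T) rowb x).+1.
rewrite (@hshift_ext f (fun r => if r < n then f r else 0)) => [|x xT]; last first.
  rewrite ifT // ltnS; exact: (leq_bigmax_seq (F := rowb)).
apply: (base n) => [i j ij|r nr]; last by rewrite ifF //; lia.
have := nf i j ij; case: ifP => // jn; rewrite ifT //; lia.
Qed.

(** * Spreading a tableau along an antidiagonal *)

Definition transp (x : box) : box := Box (colb x) (rowb x).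

Lemma transpK : involutive transp.
Proof. by move=> x; rewrite /transp !rcE BoxK. Qed.

Lemma adj_transp x y : adj (transp x) (transp y) = adj x y.
Proof. by rewrite /adj !rcE; apply/idP/idP; lia. Qed.

Lemma transp_le x y : (transp x <= transp y)%O = (x <= y)%O.
Proof. by rewrite !box_leE !rcE andbC. Qed.

Definition transpose (T : tableau) : tableau :=
  delete_dots (filling [fset transp y | y : box in domf T] (fun x => T.[? transp x])).

Lemma mem_transp (S : {fset box}) x :
  (x \in [fset transp y | y : box in S]) = (transp x \in S).
Proof.
apply/imfsetP/idP => [[y /= yS ->]|xS]; first by rewrite transpK.
by exists (transp x); rewrite /= ?transpK.
Qed.

Lemma fnd_transpose T x : (transpose T).[? x] = T.[? transp x].
Proof.
by rewrite fnd_delete_dots mem_transp; case: ifP => // /negbT h; rewrite not_fnd.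
Qed.

Lemma transposeK T : transpose (transpose T) = T.
Proof. by apply/fmapP => x; rewrite !fnd_transpose transpK. Qed.

Lemma slide_rel_transpose S (T0 T1 : tableau) :
  slide_rel S (fnd T0) (fnd T1) ->
  slide_rel [fset transp y | y : box in S] (fnd (transpose T0)) (fnd (transpose T1)).
Proof.
case=> cS sub0 sub1 s0 s1 d0 d1 le le_adj del ins.
split.
- move=> x y z; rewrite !mem_transp -(transp_le x) -(transp_le y); exact: cS.
- by move=> x a; rewrite fnd_transpose mem_transp; apply: sub0.
- by move=> x a; rewrite fnd_transpose mem_transp; apply: sub1.
- by move=> x y a b; rewrite !fnd_transpose -(adj_transp x); apply: s0.
- by move=> x y a b; rewrite !fnd_transpose -(adj_transp x); apply: s1.
- by move=> x y; rewrite fnd_transpose !mem_transp -(adj_transp x); apply: d0.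
- by move=> x y; rewrite fnd_transpose !mem_transp -(adj_transp x); apply: d1.
- by move=> x a b; rewrite !fnd_transpose; apply: le.
- by move=> x y a b; rewrite !fnd_transpose -(adj_transp x); apply: le_adj.
- move=> x a; rewrite !fnd_transpose => /del[|[y yx ty]]; [by left|right].
  by exists (transp y); rewrite ?fnd_transpose ?transpK // -adj_transp transpK.
- move=> x a; rewrite !fnd_transpose => /ins[|[y xy ty]]; [by left|right].
  by exists (transp y); rewrite ?fnd_transpose ?transpK // -adj_transp transpK.
Qed.

Lemma transpose_sim T T' : sim T T' -> sim (transpose T) (transpose T').
Proof.
have h T1 T2 : jdt_equivalent T1 T2 -> jdt_equivalent (transpose T1) (transpose T2).
  elim=> [x y|x|x y z _ IH1 _ IH2]; last 2 first.
  - exact: rt_refl.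
  - exact: rt_trans IH1 IH2.
  move=> /slide_step_rel[S [|] /slide_rel_transpose/sim_slide[]] //.
by case=> h1 h2; split; apply: h.
Qed.

Lemma transpose_increasing T : increasing T -> increasing (transpose T).
Proof.
move=> /increasingP[cT sT]; apply/increasingP; split.
  move=> x y z; rewrite -!fndSome !fnd_transpose !fndSome.
  rewrite -(transp_le x) -(transp_le y); exact: cT.
by move=> x y a b; rewrite !fnd_transpose -(adj_transp x); apply: sT.
Qed.

(** The row reading together with its boxes: the pair [s], [w] determines [T] by [reads_inj]. *)
Definition reads (T : tableau) (s : seq box) (w : seq int) : Prop :=
  [/\ pairwise row_before s, s =i domf T & map (fnd T) s = map Some w].

Lemma pmap_map_Some (t : box -> option int) s w :
  map t s = map Some w -> pmap t s = w.
Proof. by elim: s w => [|x s IH] [|a w] //= [-> /IH ->]. Qed.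

Lemma pmap_all_Some (t : box -> option int) s :
  (forall x, x \in s -> t x <> None) -> map t s = map Some (pmap t s).
Proof.
elim: s => //= x s IH h; rewrite IH => [|y ys]; last by apply: h; rewrite inE ys orbT.
by have := h x (mem_head _ _); case: (t x).
Qed.

Lemma reads_word T s w : reads T s w -> reading_word T w.
Proof.
case=> ps sT e; exists s; first exact: row_before_reading.
by rewrite (pmap_map_Some e).
Qed.

Lemma reads_filter T s : pairwise row_before s -> {subset domf T <= s} ->
  reads T [seq x <- s | x \in domf T] (pmap (fnd T) s).
Proof.
move=> ps sub; split.
- exact: subseq_pairwise (filter_subseq _ _) ps.
- by move=> x; rewrite mem_filter; case xT: (x \in domf T) => //=; rewrite sub.
- rewrite -pmap_filter_dom; apply: pmap_all_Some => x.
  by rewrite mem_filter => /andP[/mem_fnd[u ->]].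
Qed.

Lemma reads_exists T : exists s w, reads T s w.
Proof.
have [n bd] := boxes_bounded (domf T).
do 2!eexists; apply: (reads_filter (pairwise_rows n)) => x /bd[]; exact: mem_rows.
Qed.

Lemma reads_inj T T' s w : reads T s w -> reads T' s w -> T = T'.
Proof.
move=> [_ sT e] [_ sT' e']; apply/fmapP => x.
have [xs|xs] := boolP (x \in s).
  by have /eq_in_map h : map (fnd T) s = map (fnd T') s; [rewrite e e'|apply: h].
by rewrite !not_fnd // -?sT -?sT'.
Qed.

Definition shift_box (f : nat -> nat) (x : box) : box :=
  Box (rowb x) (colb x + f (rowb x)).

Lemma fnd_hshift_box f T x : (hshift f T).[? shift_box f x] = T.[? x].
Proof.
case tx: T.[? x] => [u|].
  by apply/fnd_hshift; exists (colb x); rewrite !rcE BoxK.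
case e: (hshift f T).[? _] => [u|//].
by have [a []] := proj1 (fnd_hshift _ _ _ _) e; rewrite !rcE => /addIn <-; rewrite BoxK tx.
Qed.

Lemma reads_hshift f T s w : reads T s w -> reads (hshift f T) (map (shift_box f) s) w.
Proof.
case=> ps sT e; split.
- rewrite pairwise_map; apply: sub_pairwise ps => x y.
  rewrite /row_before /= !rcE => /orP[->//|/andP[/eqP er ec]].
  by rewrite er eqxx /= orbC ltn_add2r ec.
- move=> x; apply/mapP/idP => [[y ys ->]|/mem_hshift[a [xa aT]]].
    by apply/mem_hshift; exists (colb y); rewrite !rcE BoxK -sT.
  by exists (Box (rowb x) a); [rewrite sT|apply: box_eqP; rewrite !rcE].
- rewrite -map_comp -e; apply: eq_map => x; exact: fnd_hshift_box.
Qed.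

Definition stair (x y : box) : bool := (rowb y < rowb x) && (colb x <= colb y).

Lemma stair_row_before x y : stair x y -> row_before x y.
Proof. by rewrite /stair /row_before => /andP[->]. Qed.

Definition target m (s : seq box) : seq box :=
  [seq Box (rowb (nth (Box 0 0) s i)) (i.+1 * m) | i <- iota 0 (size s)].

(** With one box in each row, a row shift can place every box independently, provided that the
    shifts grow upwards; the columns of [target] depend only on the position in the reading. *)
Lemma reads_target T s w m : increasing T -> reads T s w -> pairwise stair s ->
  (forall x, x \in s -> colb x <= m) ->
  exists T', [/\ sim T T', increasing T' & reads T' (target m s) w].
Proof.
move=> iT rT ps sm.
pose b i := nth (Box 0 0) s i.
(* The maximum over the rows from [r] downwards makes [f] nonincreasing. On the row of [b i] it is
   attained at [i]: for [k < i] the term is at most [i * m], and [colb (b i) <= m]. *)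
pose f r := \max_(i < size s | r <= rowb (b i)) (i.+1 * m - colb (b i)).
have nf : noninc f.
  move=> i j ij; apply/bigmax_leqP => k jk.
  by apply: (leq_bigmax_cond (F := fun k : 'I_(size s) => k.+1 * m - colb (b k))); lia.
have stairP i j : i < j -> j < size s -> stair (b i) (b j).
  move=> ij js; move/(pairwiseP (Box 0 0)): ps => h; apply: h => //.
  by rewrite inE; apply: ltn_trans js.
have fE i : i < size s -> f (rowb (b i)) = i.+1 * m - colb (b i).
  move=> si; apply/eqP; rewrite eqn_leq; apply/andP; split; last first.
    apply: (leq_bigmax_cond (F := fun k : 'I_(size s) => k.+1 * m - colb (b k)) (Ordinal si)).
    by rewrite /=.
  apply/bigmax_leqP => k /= hk; case: (ltngtP k i) => [ki|ik|->]; last by [].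
    have := sm _ (mem_nth (Box 0 0) si); rewrite -/(b i) => bm.
    have : k.+1 * m <= i * m by rewrite leq_mul2r ki orbT.
    by rewrite mulSn; lia.
  by have := stairP _ _ ik (ltn_ord k); rewrite /stair; lia.
exists (hshift f T); split; [exact: hshift_sim|exact: hshift_increasing|].
suff -> : target m s = map (shift_box f) s by apply: reads_hshift.
rewrite -[s in RHS](mkseq_nth (Box 0 0)) /mkseq -map_comp; apply/eq_in_map => i.
rewrite mem_iota add0n => /andP[_ si]; apply: box_eqP; rewrite /= !rcE //.
rewrite -/(b i) fE // subnKC //.
apply: leq_trans (sm _ (mem_nth _ si)) _; exact: leq_pmull.
Qed.

Lemma reads_transpose T s w : reads T s w ->
  pairwise row_before (rev (map transp s)) ->
  reads (transpose T) (rev (map transp s)) (rev w).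
Proof.
case=> ps sT e ps'; split=> //.
  move=> x; rewrite mem_rev -fndSome fnd_transpose fndSome -sT.
  by rewrite -{1}(transpK x) mem_map //; apply: inv_inj transpK.
rewrite !map_rev -map_comp -e; congr rev; apply: eq_map => x /=.
by rewrite fnd_transpose transpK.
Qed.

Definition canon n m : seq box :=
  [seq Box ((n - i) * m) (i.+1 * m) | i <- iota 0 n].

Lemma pairwise_rev (A : Type) (r : rel A) s :
  pairwise r (rev s) = pairwise (fun x y => r y x) s.
Proof.
elim: s => //= x s IH; rewrite rev_cons pairwise_rcons IH all_rev.
by [].
Qed.

(** Stated for all large [m], so that two tableaux with the same word can be given a common spacing
    and hence the same boxes. *)
Lemma reads_canon T s w : increasing T -> reads T s w ->
  exists m0, forall m, m0 <= m -> exists T',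
    [/\ sim T T', increasing T' & reads T' (canon (size w) m) w].
Proof.
move=> iT rT.
have size_s : size s = size w by case: rT => _ _ /(congr1 size); rewrite !size_map.
have [n sn] := boxes_bounded s.
(* Successive rows move apart by [n], which exceeds every column index, so no two boxes share a
   column afterwards. *)
pose f r := (n - r) * n.
have nf : noninc f by move=> i j ij; rewrite /f leq_mul2r leq_sub2l ?orbT.
pose T1 := hshift f T; pose s1 := map (shift_box f) s.
have iT1 : increasing T1 by apply: hshift_increasing.
have rT1 : reads T1 s1 w by apply: reads_hshift.
have ps1 : pairwise (fun x y => (rowb y <= rowb x) && (colb x < colb y)) s1.
  rewrite pairwise_map; case: rT => ps _ _.
  apply: (sub_in_pairwise (P := mem s)) ps; last by apply/allP.
  move=> x y /sn[xr xc] /sn[yr yc]; rewrite /row_before /= !rcE.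
  case/orP => [h|/andP[/eqP -> h]]; last by rewrite leqnn ltn_add2r.
  rewrite (ltnW h) /f; have : (n - rowb x).+1 * n <= (n - rowb y) * n.
    by rewrite leq_mul2r; apply/orP; right; lia.
  by rewrite mulSn; lia.
have ps2 : pairwise stair (rev (map transp s1)).
  rewrite pairwise_rev pairwise_map; apply: sub_pairwise ps1 => x y.
  by rewrite /stair /= !rcE andbC.
(* Columns after the initial shift are below [n + n * n]; this covers both uses of [reads_target].
   The successor makes [m] positive, so that multiples of [m] are distinct. *)
exists (n + n * n).+1 => m nm.
have [|x|T2 [sT2 iT2 rT2]] :=
  reads_target (m := m) (transpose_increasing iT1) (reads_transpose rT1 _) ps2.
- by apply: sub_pairwise ps2 => x y; apply: stair_row_before.
- rewrite mem_rev => /mapP[y /mapP[z /sn[zr zc] ->] ->]; rewrite !rcE; lia.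
set s2 := target m _ in rT2.
have size2 : size s2 = size w.
  by rewrite /s2 /target size_map size_iota size_rev !size_map.
have ps3 : pairwise stair (rev (map transp s2)).
  rewrite pairwise_rev pairwise_map /s2 /target pairwise_map.
  have := iota_ltn_sorted 0 (size (rev (map transp s1))).
  rewrite (sorted_pairwise ltn_trans).
  apply: (sub_in_pairwise (P := fun i => i < size (rev (map transp s1)))).
    move=> i j hi hj ij; rewrite /stair /= !rcE; apply/andP; split.
      by rewrite ltn_pmul2r; lia.
    have /(pairwiseP (Box 0 0)) h := ps2.
    by have := h i j hi hj ij; rewrite /stair => /andP[/ltnW].
  by apply/allP => i; rewrite mem_iota.
have [|x|T3 [sT3 iT3 rT3]] :=
  reads_target (m := m) (transpose_increasing iT2) (reads_transpose rT2 _) ps3.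
- by apply: sub_pairwise ps3 => x y; apply: stair_row_before.
- rewrite mem_rev => /mapP[y /mapP[i]]; rewrite mem_iota add0n => /andP[_ hi] -> ->.
  rewrite /transp !rcE.
  have := mem_nth (Box 0 0) hi; rewrite mem_rev => /mapP[z /mapP[t /sn[tr tc] ->] ->].
  rewrite !rcE; have : f (rowb t) <= n * n by rewrite /f leq_mul2r leq_subr orbT.
  lia.
exists T3; split=> //.
  apply: sim_trans (hshift_sim nf iT) _; rewrite -/T1.
  apply: sim_trans _ sT3; rewrite -{1}[T1]transposeK; exact: transpose_sim.
move: rT3; rewrite revK; congr (reads _ _ _).
rewrite /target size_rev size_map size2 /canon; apply/eq_in_map => i.
rewrite mem_iota add0n => /andP[_ hi]; congr Box.
rewrite nth_rev size_map size2 // (nth_map (Box 0 0)) ?size2; last by lia.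
rewrite /s2 /target (nth_map 0) ?size_iota ?size_rev ?size_map ?size_s; last by lia.
rewrite nth_iota; last by lia.
by rewrite /transp !rcE add0n; congr (_ * _); lia.
Qed.

Lemma reads_sim T T' s s' w : increasing T -> increasing T' ->
  reads T s w -> reads T' s' w -> sim T T'.
Proof.
move=> iT iT' rT rT'.
have [m0 h] := reads_canon iT rT; have [m0' h'] := reads_canon iT' rT'.
have [D [sD _ rD]] := h (maxn m0 m0') (leq_maxl _ _).
have [D' [sD' _ rD']] := h' (maxn m0 m0') (leq_maxr _ _).
by apply: sim_trans sD _; rewrite (reads_inj rD rD'); apply: sim_sym.
Qed.

(** * K-Knuth relations as slides *)

Section Square.
Variables (u v : seq int) (x y p : int) (z q s : option int).
Let n := size u.
Let m := size v.
Let l := m + n + 1.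

(* Antidiagonal tableaux with a modified 2 x 2 block in rows [m], [m + 1] and
   columns [n], [n + 1]: the block [. y; x z] slides to the block [p q; s .]. *)
Definition diag0 := map Some u ++ [:: Some x; Some y] ++ map Some v.
Definition diag1 := map Some u ++ [:: s; q] ++ map Some v.

Definition in_square (b : box) : bool :=
  [|| rowb b + colb b == l, b == Box m n | isSome z && (b == Box m.+1 n.+1)].

Definition square : {fset box} :=
  [fset b in [seq b <- boxes l.+2 l.+2 | in_square b]].

Lemma mem_square b : (b \in square) = in_square b.
Proof.
rewrite /square in_fset mem_filter mem_boxes; case h: (in_square b) => //=.
by move: h; rewrite /in_square !box_eqE !rcE /l; case: (z) => [?|] /=; lia.
Qed.

Definition before (b : box) : option int :=
  if b == Box m n then None else
  if b == Box m.+1 n.+1 then z else nth None diag0 (colb b).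

Definition after (b : box) : option int :=
  if b == Box m n then Some p else
  if b == Box m.+1 n.+1 then None else nth None diag1 (colb b).

(** These are the clauses of [slide_rel] on the block: order conditions, then the origin of each new
    entry ([ins_p], [ins_s], [ins_q]) and the destination of each old one ([del_x], [del_y],
    [del_z]). Outside the block nothing changes. *)
Hypothesis zE : forall c, z = Some c -> (x < c)%R /\ (y < c)%R.
Hypothesis z_sq : z <> None -> s <> None /\ q <> None.
Hypothesis pE : (p <= x)%R /\ (p <= y)%R.
Hypothesis sE : forall c, s = Some c -> [/\ (p < c)%R, (x <= c)%R &
  (forall d, z = Some d -> (c <= d)%R)].
Hypothesis qE : forall c, q = Some c -> [/\ (p < c)%R, (y <= c)%R &
  (forall d, z = Some d -> (c <= d)%R)].
Hypothesis ins_p : p = x \/ p = y.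
Hypothesis ins_s : s = Some x \/ s = z.
Hypothesis ins_q : q = Some y \/ q = z.
Hypothesis del_x : s = Some x \/ p = x.
Hypothesis del_y : q = Some y \/ p = y.
Hypothesis del_z : s = z \/ q = z.

(** Boxes on one antidiagonal are incomparable, so every cover involves a corner of the block. *)
Lemma square_adj b c : in_square b -> in_square c -> adj b c ->
  (b = Box m n /\ (c = Box m.+1 n \/ c = Box m n.+1)) \/
  [/\ z <> None, c = Box m.+1 n.+1 & (b = Box m.+1 n \/ b = Box m n.+1)].
Proof.
rewrite /in_square !box_eqE !rcE /adj /l => hb hc bc.
have [h|h] := eqVneq (rowb b + colb b) (m + n).
  left; split; first by apply: box_eqP; rewrite !rcE; lia.
  case/orP: bc => h'; [right|left]; apply: box_eqP; rewrite !rcE; lia.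
right; have zN : z <> None by case: (z) hb hc => //=; lia.
split=> //; first by apply: box_eqP; rewrite !rcE; lia.
case/orP: bc => h'; [left|right]; apply: box_eqP; rewrite !rcE; lia.
Qed.

Let t0 := fnd (delete_dots (filling square before)).
Let t1 := fnd (delete_dots (filling square after)).

Lemma fnd_before b : in_square b -> t0 b = before b.
Proof. by rewrite /t0 fnd_delete_dots mem_square => ->. Qed.

Lemma fnd_after b : in_square b -> t1 b = after b.
Proof. by rewrite /t1 fnd_delete_dots mem_square => ->. Qed.

Lemma square_convex : convex square.
Proof.
move=> a b c; rewrite !mem_square /in_square !box_leE !box_eqE !rcE /l.
by case: (z) => /=; lia.
Qed.

Lemma in_square_nw : in_square (Box m n).
Proof. by rewrite /in_square eqxx orbT. Qed.

Lemma in_square_sw : in_square (Box m.+1 n).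
Proof. by rewrite /in_square !rcE /l; lia. Qed.

Lemma in_square_ne : in_square (Box m n.+1).
Proof. by rewrite /in_square !rcE /l; lia. Qed.

Lemma in_square_se : z <> None -> in_square (Box m.+1 n.+1).
Proof. by rewrite /in_square eqxx andbT; case: (z) => //= _ _; rewrite !orbT. Qed.

Lemma entries_nw : t0 (Box m n) = None /\ t1 (Box m n) = Some p.
Proof. by rewrite fnd_before ?fnd_after ?in_square_nw // /before /after eqxx. Qed.

Lemma entries_sw : t0 (Box m.+1 n) = Some x /\ t1 (Box m.+1 n) = s.
Proof.
rewrite fnd_before ?fnd_after ?in_square_sw // /before /after !box_eqE !rcE.
rewrite /diag0 /diag1 !nth_cat !size_map ltnn subnn.
by rewrite !ifF //; lia.
Qed.

Lemma entries_ne : t0 (Box m n.+1) = Some y /\ t1 (Box m n.+1) = q.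
Proof.
rewrite fnd_before ?fnd_after ?in_square_ne // /before /after !box_eqE !rcE.
rewrite /diag0 /diag1 !nth_cat !size_map ltnNge leqnSn subSnn.
by rewrite !ifF //; lia.
Qed.

Lemma entries_se : z <> None ->
  t0 (Box m.+1 n.+1) = z /\ t1 (Box m.+1 n.+1) = None.
Proof.
move=> zN; rewrite fnd_before ?fnd_after ?in_square_se // /before /after.
have -> : (Box m.+1 n.+1 == Box m n) = false by rewrite box_eqE !rcE; lia.
by rewrite eqxx.
Qed.

Lemma entries_other b : in_square b -> colb b <> n -> colb b <> n.+1 -> t0 b = t1 b.
Proof.
move=> bS bn bn1; rewrite fnd_before // fnd_after // /before /after.
rewrite !box_eqE !rcE [in RHS]ifF; last by lia.
rewrite [in RHS]ifF; last by lia.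
rewrite ifF; last by lia.
rewrite ifF; last by lia.
rewrite /diag0 /diag1 !nth_cat !size_map -/n; case: ifP => // /negbT.
rewrite -leqNgt => h; have -> : colb b - n = (colb b - n.+2).+2 by lia.
by [].
Qed.

Lemma square_cases b : in_square b ->
  [\/ b = Box m n, b = Box m.+1 n, b = Box m n.+1 |
    (z <> None /\ b = Box m.+1 n.+1) \/ t0 b = t1 b].
Proof.
move=> bS; have [h|/eqP h] := eqVneq (colb b) n; last first.
  have [h1|/eqP h1] := eqVneq (colb b) n.+1; last first.
    by constructor 4; right; apply: entries_other.
  move: bS; rewrite /in_square !box_eqE !rcE => /or3P[e|e|/andP[e1 e]].
  - by constructor 3; apply: box_eqP; rewrite !rcE; move: e; rewrite /l; lia.
  - by move: e; lia.
  - constructor 4; left; split; first by case: (z) e1.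
    by apply: box_eqP; rewrite !rcE; lia.
move: bS; rewrite /in_square !box_eqE !rcE => /or3P[e|e|e].
- by constructor 2; apply: box_eqP; rewrite !rcE; move: e; rewrite /l; lia.
- by constructor 1; apply: box_eqP; rewrite !rcE; lia.
- by move: e; lia.
Qed.

Lemma square_slide : slide_rel square t0 t1.
Proof.
have sub0 b a : t0 b = Some a -> b \in square.
  by rewrite /t0 fnd_delete_dots; case: ifP.
have sub1 b a : t1 b = Some a -> b \in square.
  by rewrite /t1 fnd_delete_dots; case: ifP.
have [nw0 nw1] := entries_nw; have [sw0 sw1] := entries_sw.
have [ne0 ne1] := entries_ne.
have [px py] := pE.
have adjE b c : adj b c -> b \in square -> c \in square -> _ :=
  fun bc bS cS => square_adj (etrans (esym (mem_square b)) bS)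
                             (etrans (esym (mem_square c)) cS) bc.
split=> //; first exact: square_convex.
- move=> b c d e bc tb tc; have := adjE _ _ bc (sub0 _ _ tb) (sub0 _ _ tc).
  case=> [[be _]|[/entries_se[se0 _] ce [] be]]; first by rewrite be nw0 in tb.
    rewrite ce se0 in tc; have [xe _] := zE tc.
    by move: tb; rewrite be sw0 => -[<-].
  rewrite ce se0 in tc; have [_ ye] := zE tc.
  by move: tb; rewrite be ne0 => -[<-].
- move=> b c d e bc tb tc; have := adjE _ _ bc (sub1 _ _ tb) (sub1 _ _ tc).
  case=> [[be [] ce]|[/entries_se[_ se1] ce _]]; last by rewrite ce se1 in tc.
    rewrite ce sw1 in tc; have [pe _ _] := sE tc.
    by move: tb; rewrite be nw1 => -[<-].
  rewrite ce ne1 in tc; have [pe _ _] := qE tc.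
  by move: tb; rewrite be nw1 => -[<-].
- move=> b c bc bS cS; case: (adjE _ _ bc bS cS) => [[_ [] ->]|[zN -> _]].
  + by rewrite sw0.
  + by rewrite ne0.
  + by have [-> _] := entries_se zN.
- move=> b c bc bS cS; case: (adjE _ _ bc bS cS) => [[-> _]|[zN _ []->]].
  + by rewrite nw1.
  + by rewrite sw1; have [] := z_sq zN.
  + by rewrite ne1; have [] := z_sq zN.
- move=> b c d tb tb'; have bS := sub0 _ _ tb; rewrite mem_square in bS.
  case: (square_cases bS) => [e|e|e|[[zN e]|e]].
  + by rewrite e nw0 in tb.
  + move: tb tb'; rewrite e sw0 sw1 => -[<-] /sE[]//.
  + move: tb tb'; rewrite e ne0 ne1 => -[<-] /qE[]//.
  + by have [_ e'] := entries_se zN; rewrite e e' in tb'.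
  + by move: tb; rewrite e tb' => -[->].
- move=> b c d e bc tb tc; have := adjE _ _ bc (sub1 _ _ tb) (sub0 _ _ tc).
  case=> [[be [] ce]|[/entries_se[se0 _] ce [] be]].
  + by move: tb tc; rewrite be ce nw1 sw0 => -[<-] [<-].
  + by move: tb tc; rewrite be ce nw1 ne0 => -[<-] [<-].
  + move: tb tc; rewrite be ce sw1 se0 => /sE[_ _ h]; exact: h.
  + move: tb tc; rewrite be ce ne1 se0 => /qE[_ _ h]; exact: h.
- move=> b c tb; have bS := sub0 _ _ tb; rewrite mem_square in bS.
  case: (square_cases bS) => [e|e|e|[[zN e]|e]].
  + by rewrite e nw0 in tb.
  + rewrite e sw0 in tb *; rewrite sw1 -tb.
    case: del_x => [->|<-]; [by left|right]; exists (Box m n) => //; exact: adjD.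
  + rewrite e ne0 in tb *; rewrite ne1 -tb.
    case: del_y => [->|<-]; [by left|right]; exists (Box m n) => //; exact: adjR.
  + have [se0 _] := entries_se zN; rewrite e se0 in tb *; rewrite -tb; right.
    case: del_z => <-; first by exists (Box m.+1 n); rewrite ?adjR.
    by exists (Box m n.+1); rewrite ?adjD.
  + by left; rewrite -e.
- move=> b c tb; have bS := sub1 _ _ tb; rewrite mem_square in bS.
  case: (square_cases bS) => [e|e|e|[[zN e]|e]].
  + rewrite e nw1 in tb *; rewrite -tb; right.
    case: ins_p => ->; first by exists (Box m.+1 n); rewrite ?adjD.
    by exists (Box m n.+1); rewrite ?adjR.
  + rewrite e sw1 in tb *; rewrite sw0 -tb.
    case: ins_s => [->|sz]; [by left|right].
    have zN : z <> None by rewrite -sz tb.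
    exists (Box m.+1 n.+1); rewrite ?adjR //; have [-> _] := entries_se zN.
    by rewrite sz.
  + rewrite e ne1 in tb *; rewrite ne0 -tb.
    case: ins_q => [->|qz]; [by left|right].
    have zN : z <> None by rewrite -qz tb.
    exists (Box m.+1 n.+1); rewrite ?adjD //; have [-> _] := entries_se zN.
    by rewrite qz.
  + by have [_ se1] := entries_se zN; rewrite e se1 in tb.
  + by left; rewrite e.
Qed.

(** All four boxes of the block are listed, whether or not they carry an entry; [reads_filter] drops
    the empty ones. *)
Definition square_reading : seq box :=
  [seq Box (l - c) c | c <- iota 0 n] ++
  [:: Box m.+1 n; Box m.+1 n.+1; Box m n; Box m n.+1] ++
  [seq Box (l - c) c | c <- iota n.+2 m].

Lemma pairwise_square_reading : pairwise row_before square_reading.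
Proof.
have diag k i : k + i <= l.+1 -> pairwise row_before [seq Box (l - c) c | c <- iota k i].
  move=> kl; rewrite pairwise_map.
  have := iota_ltn_sorted k i; rewrite (sorted_pairwise ltn_trans).
  apply: (sub_in_pairwise (P := fun c => c <= l)); last first.
    by apply/allP => c; rewrite mem_iota; lia.
  by move=> c d hc hd cd; rewrite /row_before /= !rcE; lia.
rewrite /square_reading pairwise_cat diag ?pairwise_cat ?diag /l; try lia.
rewrite /= /row_before !rcE !andbT; apply/and3P; split.
- apply/allrelP => b c /mapP[i]; rewrite mem_iota => hi ->.
  rewrite !in_cons => /or4P[/eqP->|/eqP->|/eqP->|/orP[/eqP->|/mapP[j]]];
    try by rewrite !rcE; lia.
  by rewrite mem_iota => hj ->; rewrite !rcE; lia.
- apply/allrelP => b c; rewrite !inE => h /mapP[j]; rewrite mem_iota => hj ->.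
  by case/or4P: h => /eqP ->; rewrite !rcE; lia.
- by lia.
Qed.

Lemma square_sub : {subset square <= square_reading}.
Proof.
move=> b; rewrite mem_square /in_square /square_reading !mem_cat !inE.
have [h|h] := boolP ((rowb b + colb b == l) && (colb b != n) && (colb b != n.+1)).
  move=> _; have bE : b = Box (l - colb b) (colb b).
    by apply: box_eqP; rewrite !rcE; lia.
  have [c|c] := ltnP (colb b) n.
    by apply/orP; left; apply/mapP; exists (colb b); rewrite // mem_iota; lia.
  do 2!(apply/orP; right); apply/mapP; exists (colb b); rewrite // mem_iota /l in h *.
  by lia.
rewrite !box_eqE !rcE; case: (z) => [?|] /=; rewrite /l in h *; lia.
Qed.

Lemma pmap_square_reading t w : (forall b, colb b < n \/ n.+1 < colb b ->
    rowb b + colb b = l -> t b = nth None diag0 (colb b)) ->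
  pmap t [:: Box m.+1 n; Box m.+1 n.+1; Box m n; Box m n.+1] = w ->
  pmap t square_reading = u ++ w ++ v.
Proof.
move=> te <-; rewrite /square_reading !pmap_cat; congr (_ ++ (_ ++ _)).
  rewrite -[RHS](mkseq_nth 0%R) /mkseq; apply: pmap_map_Some.
  rewrite -!map_comp; apply/eq_in_map => c; rewrite mem_iota => hc /=.
  rewrite te ?rcE; [|by left; lia|by rewrite /l; lia].
  by rewrite /diag0 nth_cat size_map -/n ifT ?(nth_map 0%R) //; lia.
rewrite -[RHS](mkseq_nth 0%R) /mkseq; apply: pmap_map_Some.
rewrite -[n.+2]addn0 iotaDl -!map_comp; apply/eq_in_map => c; rewrite mem_iota => hc /=.
rewrite te ?rcE; [|by right; lia|by rewrite /l; lia].
rewrite /diag0 nth_cat size_map -/n ifF; last by lia.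
by rewrite (_ : n.+2 + c - n = c.+2) /= ?(nth_map 0%R) //; lia.
Qed.

Lemma square_sim : exists T T' r r', [/\ increasing T, increasing T', sim T T',
  reads T r (u ++ (x :: seq_of_opt z ++ [:: y]) ++ v) &
  reads T' r' (u ++ (seq_of_opt s ++ p :: seq_of_opt q) ++ v)].
Proof.
have sl := square_slide.
exists (delete_dots (filling square before)), (delete_dots (filling square after)).
have [nw0 nw1] := entries_nw; have [sw0 sw1] := entries_sw.
have [ne0 ne1] := entries_ne.
have se0 : t0 (Box m.+1 n.+1) = z.
  case zE' : z => [c|]; first by have [|-> _] := entries_se; rewrite zE'.
  by rewrite /t0 fnd_delete_dots mem_square /in_square zE' /= box_eqE !rcE ifF /l //; lia.
have se1 : t1 (Box m.+1 n.+1) = None.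
  case zE' : z => [c|]; first by have [|_ ->] := entries_se; rewrite ?zE'.
  by rewrite /t1 fnd_delete_dots mem_square /in_square zE' /= box_eqE !rcE ifF /l //; lia.
have diag b : colb b < n \/ n.+1 < colb b -> rowb b + colb b = l ->
    t0 b = nth None diag0 (colb b).
  move=> bn bl; have bS : in_square b by rewrite /in_square bl eqxx.
  by rewrite fnd_before // /before !box_eqE !rcE !ifF //; lia.
have r0 := @reads_filter (delete_dots (filling square before)) _ pairwise_square_reading.
have r1 := @reads_filter (delete_dots (filling square after)) _ pairwise_square_reading.
do 2!eexists; split.
- exact: slide_rel_increasing0 sl.
- exact: slide_rel_increasing1 sl.
- exact: sim_slide sl.
- have e : pmap t0 square_reading = u ++ (x :: seq_of_opt z ++ [:: y]) ++ v.
    apply: pmap_square_reading => //=.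
    by rewrite sw0 se0 nw0 ne0 /=; case: (z).
  rewrite -e; apply: r0 => b bT; apply: square_sub.
  exact: (fsubsetP (slide_rel_sub0 sl)).
- have e : pmap t1 square_reading = u ++ (seq_of_opt s ++ p :: seq_of_opt q) ++ v.
    apply: pmap_square_reading => [b bn bl|/=].
      rewrite -diag // entries_other //; try lia.
      by rewrite /in_square bl eqxx.
    by rewrite sw1 se1 nw1 ne1 /=; case: (s); case: (q).
  rewrite -e; apply: r1 => b bT; apply: square_sub.
  exact: (fsubsetP (slide_rel_sub1 sl)).
Qed.

End Square.

(** The blocks are [[. a; a .]] to [[a .; . .]] for [a a = a]; [[. d; d e]] to [[d e; e .]] for
    [d e d = e d e] with [d < e]; [[. b; a c]] to [[b c; a .]] for [a c b = a b c] with [b < a < c];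
    [[. c; a b]] to [[a c; b .]] for [a b c = b a c] with [a < c < b]. Equal words occur when both
    letters of a braid coincide. *)
Lemma kknuth_step_sim w w' : kknuth_step w w' -> w = w' \/
  exists T T' r r', [/\ increasing T, increasing T', sim T T',
    reads T r w & reads T' r' w'].
Proof.
have flip (w1 w2 : seq int) :
    (exists T T' r r', [/\ increasing T, increasing T', sim T T',
      reads T r w1 & reads T' r' w2]) ->
    exists T T' r r', [/\ increasing T, increasing T', sim T T',
      reads T r w2 & reads T' r' w1].
  by move=> [T [T' [r [r' [i1 i2 /sim_sym h r1 r2]]]]]; exists T', T, r', r.
case=> [u v a|u v a b|u v a b c|u v a b c].
- right; apply: (@square_sim u v a a a None None None) => //; try by [left|right].
- have braid d e : (d < e)%R -> exists T T' r r', [/\ increasing T, increasing T',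
      sim T T', reads T r (u ++ [:: d; e; d] ++ v) & reads T' r' (u ++ [:: e; d; e] ++ v)].
    move=> de; apply: (@square_sim u v d d d (Some e) (Some e) (Some e)) => //;
      try (by [left|right]); move=> ? [<-]; split=> //; try exact: ltW.
      by move=> ? [<-].
    by move=> ? [<-].
  have [ab|ba|->] := ltgtP a b; [|by right; apply/flip/braid|by left].
  by right; apply: braid.
- move=> /andP[ba ac]; right; apply: flip.
  have bc := lt_trans ba ac.
  apply: (@square_sim u v a b b (Some c) (Some c) (Some a)) => //; try (by [left|right]).
  + by move=> ? [<-].
  + by split=> //; apply: ltW.
  + by move=> ? [<-]; split=> // ? [<-]; apply: ltW.
  + by move=> ? [<-]; split=> //; [apply: ltW|move=> ? [<-]].
- move=> /andP[ac cb]; right.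
  have ab := lt_trans ac cb.
  apply: (@square_sim u v a c a (Some b) (Some c) (Some b)) => //; try (by [left|right]).
  + by move=> ? [<-].
  + by split=> //; apply: ltW.
  + by move=> ? [<-]; split=> //; [apply: ltW|move=> ? [<-]].
  + by move=> ? [<-]; split=> // ? [<-]; apply: ltW.
Qed.

Lemma kk_sim w w' T T' r r' : w =K w' -> increasing T -> increasing T' ->
  reads T r w -> reads T' r' w' -> sim T T'.
Proof.
pose readable w := exists T r, increasing T /\ reads T r w.
pose similar w w' := forall T T' r r', increasing T -> increasing T' ->
  reads T r w -> reads T' r' w' -> sim T T'.
(* Transitivity needs a tableau that reads the middle word, so readability is part of the induction.
   The alternative [w = w'] covers reflexivity, where no tableau is at hand. *)
move=> ww'; suff [<-|[_ _ h]] : w = w' \/ [/\ readable w, readable w' & similar w w'].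
- exact: reads_sim.
- exact: h.
elim: ww' => {w w' T T' r r'} [w w'|w|w w' _ IH|w1 w2 w3 _ IH1 _ IH2].
- case/kknuth_step_sim => [|[T [T' [r [r' [i1 i2 s r1 r2]]]]]]; first by left.
  right; split; [by exists T, r|by exists T', r'|].
  move=> U U' q q' j1 j2 q1 q2; apply: sim_trans (reads_sim j1 i1 q1 r1) _.
  by apply: sim_trans s _; apply: reads_sim r2 q2.
- by left.
- case: IH => [->|[h1 h2 h]]; [by left|right; split=> //].
  by move=> U U' q q' j1 j2 q1 q2; apply/sim_sym; apply: h q2 q1.
- case: IH1 => [->//|[h1 h2 h]]; case: IH2 => [<-|[_ h3 h']]; first by right.
  right; split=> // U U' q q' j1 j2 q1 q2.
  have [V [t [iV rV]]] := h2.
  by apply: sim_trans (h _ _ _ _ j1 iV q1 rV) (h' _ _ _ _ iV j2 rV q2).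
Qed.

Lemma jdt_increasing T T' : jdt_equivalent T T' -> increasing T -> increasing T'.
Proof.
elim=> [T1 T2|//|T1 T2 T3 _ IH1 _ IH2 /IH1/IH2 //].
by case/slide_step_rel => S []; [move/slide_rel_increasing1|move/slide_rel_increasing0].
Qed.

Theorem theorem6p2 (T T' : tableau) (hT : increasing T) (hT' : increasing T') :
  kknuth_equivalent T T' <-> jdt_equivalent T T'.
Proof.
have [s [w rT]] := reads_exists T; have [s' [w' rT']] := reads_exists T'.
split=> [[v [v' [hv hv' vv']]]|TT'].
  have ww' : w =K w'.
    apply: kk_trans (reading_word_kk hT (reads_word rT) hv) _.
    exact: kk_trans vv' (reading_word_kk hT' hv' (reads_word rT')).
  by have [] := kk_sim ww' hT hT' rT rT'.
exists w, w'; split; [exact: reads_word rT|exact: reads_word rT'|].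
elim: TT' hT hT' s w rT s' w' rT' => {T T'}
  [T T' /slide_step_kk[v [v' [hv hv' vv']]]|T|T1 T2 T3 h12 IH1 h23 IH2]
  hT hT' s w rT s' w' rT'.
- apply: kk_trans (reading_word_kk hT (reads_word rT) hv) _.
  exact: kk_trans vv' (reading_word_kk hT' hv' (reads_word rT')).
- exact: reading_word_kk hT (reads_word rT) (reads_word rT').
- have hT2 : increasing T2.
    exact: jdt_increasing h12 hT.
  have [s2 [w2 rT2]] := reads_exists T2.
  exact: kk_trans (IH1 hT hT2 _ _ rT _ _ rT2) (IH2 hT2 hT' _ _ rT2 _ _ rT').
Qed.
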